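(* Let $X=X_\Sigma$ be a smooth projective toric variety and let $X\dashrightarrow X^+=X_{\Sigma^+}$ be the anti-flip with respect to an extremal primitive relation \[ u_1+\cdots+u_l=v_1+\cdots+v_m\quad (l<m) \] of $\Sigma$, where $\{u_1,\ldots,u_l,v_1,\ldots,v_m\}\subset\mathrm{G}(\Sigma)$. Then $X^+$ is also a smooth projective toric variety, and the primitive collections of $\Sigma^+$ are (1) $\{v_1,\ldots,v_m\}$, whose primitive relation is $v_1+\cdots+v_m=u_1+\cdots+u_l$; (2) any primitive collection $P$ of $\Sigma$ such that $\{v_1,\ldots,v_m\}\not\subset P$ and $P\neq\{u_1,\ldots,u_l\}$; and (3) $\left(P\setminus\{v_1,\ldots,v_m\}\right)\cup\{u_1,\ldots,u_l\}$ for any primitive collection $P$ of $\Sigma$ such that $P\setminus\{v_1,\ldots,v_m\}$ is a minimal element (with respect to inclusion) in \[ \left\{Q\setminus\{v_1,\ldots,v_m\}\,\left|\,Q\mbox{ is a primitive collection of }\Sigma,\ Q\cap\{v_1,\ldots,v_m\}\neq\emptyset\right.\right\} \] and $(P\setminus\{v_1,\ldots,v_m\})\cup S$ does not contain a primitive collection of $\Sigma$ for any proper subset $S\subset\{u_1,\ldots,u_l\}$.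
   Context: Everything is over an algebraically closed field $K$. Let $X=X_\Sigma$ be the smooth projective toric $d$-fold of a fan $\Sigma$ in $N=\mathbb{Z}^d$, and let $\mathrm{G}(\Sigma)\subset N$ be the set of primitive generators of the 1-dimensional cones of $\Sigma$. A non-empty subset $P\subset \mathrm{G}(\Sigma)$ is a primitive collection of $\Sigma$ (or of $X$) if $P$ does not generate a cone in $\Sigma$ but $P\setminus\{u\}$ generates a cone in $\Sigma$ for every $u\in P$. For a primitive collection $P=\{u_1,\ldots,u_l\}$ there is a unique cone $\sigma(P)\in\Sigma$ containing $u_1+\cdots+u_l$ in its relative interior. If $v_1,\ldots,v_m\in\mathrm{G}(\Sigma)$ are the generators of $\sigma(P)$ ($m=\dim\sigma(P)$), then $u_1+\cdots+u_l=a_1v_1+\cdots+a_mv_m$ with positive integers $a_i$, and this is the primitive relation of $P$. Each primitive relation, being a linear relation among elements of $\mathrm{G}(\Sigma)$, determines a numerical 1-cycle on $X$ (its intersection numbers with the torus invariant prime divisors corresponding to the elements of $\mathrm{G}(\Sigma)$ are the coefficients of the relation $u_1+\cdots+u_l-a_1v_1-\cdots-a_mv_m=0$). These 1-cycles generate the polyhedral Kleiman-Mori cone ${\rm NE}(X)$. A primitive collection (or relation) is extremal if its numerical 1-cycle generates an extremal ray $R\subset {\rm NE}(X)$; it then defines the extremal contraction $\varphi_R:X\to\overline{X}$. If $m\ge 2$, $\varphi_R$ is a small contraction, and it is called anti-flipping if $l-(a_1+\cdots+a_m)<0$ (this number is the degree $-K_X\cdot C$ of the associated 1-cycle $C$).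 In that case the anti-flip with respect to the relation is the birational map $X\dashrightarrow X^+$ over $\overline{X}$, where $\varphi_R^+:X^+\to\overline{X}$ is the small projective toric birational morphism such that $-K_{X^+}$ is $\varphi^+_R$-ample. Equivalently, it is the inverse of a flip. $\Sigma^+$ denotes the fan of $X^+$ in $N$, and $\mathrm{G}(\Sigma^+)=\mathrm{G}(\Sigma)$. *)

(* Defs.v *)
From mathcomp Require Import all_boot all_order all_algebra.
From mathcomp Require Import finmap.
From mathcomp Require Import boolp classical_sets cardinality reals.

Set Implicit Arguments.
Unset Strict Implicit.
Unset Printing Implicit Defensive.

Import Order.TTheory GRing.Theory Num.Theory.

Local Open Scope classical_set_scope.
Local Open Scope fset_scope.
Local Open Scope ring_scope.

(* A toric variety is represented by its fan in N = Z^d.  Cones are subsets   *)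
(* of N_R = R^d, and the geometric notions are given by the usual toric       *)
(* dictionary.                                                                *)

Notation lattice d := 'rV[int]_d.

Section Cones.
Variables (R : realFieldType) (d : nat).
Local Notation NR := 'rV[R]_d.

Definition toNR (u : lattice d) : NR := map_mx intr u.

Definition pairing (m x : NR) : R := (m *m x^T) 0 0.

Definition cone (s : seq (lattice d)) : set NR :=
  [set x | exists2 c : lattice d -> R,
     (forall u, 0 <= c u) & x = \sum_(u <- s) c u *: toNR u].

Definition rational_polyhedral (sigma : set NR) : Prop :=
  exists s : seq (lattice d), sigma = cone s.

Definition strongly_convex (sigma : set NR) : Prop :=
  forall x, sigma x -> sigma (- x) -> x = 0.

Definition face (tau sigma : set NR) : Prop :=
  exists2 h : NR,
    (forall x, sigma x -> 0 <= pairing h x) &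
    tau = [set x | sigma x /\ pairing h x = 0].

(* For a convex polyhedral cone this is the topological interior of the cone  *)
(* in its linear span.                                                        *)
Definition relint (sigma : set NR) : set NR :=
  [set x | sigma x /\ forall tau, face tau sigma -> tau x -> tau = sigma].

Definition primitive_vector (u : lattice d) : Prop :=
  u != 0 /\ forall (k : int) (w : lattice d), u = k *: w -> k = 1 \/ k = -1.

Definition ray_gens (sigma : set NR) : set (lattice d) :=
  [set u | primitive_vector u /\ face (cone [:: u]) sigma].

Record fan := Fan {
  fan_cones :> set NR -> Prop;
  fan_finite : finite_set (fan_cones : set (set NR));
  fan_nonempty : exists sigma, fan_cones sigma;
  fan_polyhedral : forall sigma, fan_cones sigma -> rational_polyhedral sigma;
  fan_strongly_convex : forall sigma, fan_cones sigma -> strongly_convex sigma;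
  fan_face : forall sigma tau, fan_cones sigma -> face tau sigma ->
    fan_cones tau;
  fan_inter : forall sigma tau, fan_cones sigma -> fan_cones tau ->
    face (sigma `&` tau)%classic sigma /\ face (sigma `&` tau)%classic tau
}.

End Cones.

Arguments toNR R {d} u.
Arguments cone R {d} s.

Section Fans.
Variables (R : realFieldType) (d : nat).
Local Notation NR := 'rV[R]_d.
Implicit Types Sigma : fan R d.

Definition G Sigma : set (lattice d) :=
  [set u | primitive_vector u /\ Sigma (cone R [:: u])].

Definition maximal_cone Sigma (sigma : set NR) : Prop :=
  Sigma sigma /\
  forall tau, Sigma tau -> (sigma `<=` tau)%classic -> tau = sigma.

Definition smooth Sigma : Prop :=
  forall sigma, Sigma sigma ->
  exists (B : 'M[int]_d) (I : {set 'I_d}),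
    B \in unitmx /\ sigma = cone R [seq row i B | i <- enum I].

Definition support Sigma : set NR :=
  [set x | exists2 sigma, Sigma sigma & sigma x].

Definition complete Sigma : Prop := support Sigma = setT.

(* Ampleness over C of the divisor D = \sum_(u in G Sigma) a u * D_u, in      *)
(* terms of its local data m_sigma: C is the whole space in the absolute case *)
(* and runs over the cones of the base in the relative case.  In a complete   *)
(* fan sigma is full-dimensional, so m_sigma is rational and unique, and      *)
(* its existence says that D is Q-Cartier.                                    *)
Definition ample_on Sigma (a : lattice d -> int) (C : set NR) : Prop :=
  forall sigma, maximal_cone Sigma sigma -> (sigma `<=` C)%classic ->
  exists m : NR,
    (forall u, ray_gens sigma u -> pairing m (toNR R u) = - (a u)%:~R) /\
    (forall u, G Sigma u -> C (toNR R u) -> ~ sigma (toNR R u) ->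
       - (a u)%:~R < pairing m (toNR R u)).

Definition ample Sigma a : Prop := ample_on Sigma a setT.

Definition projective Sigma : Prop :=
  complete Sigma /\ exists a, ample Sigma a.

Definition generates (Sigma : fan R d) (P : {fset lattice d}) : Prop :=
  Sigma (cone R P).

Definition primitive_collection Sigma (P : {fset lattice d}) : Prop :=
  [/\ P != fset0,
      forall u, u \in P -> G Sigma u,
      ~ generates Sigma P
    & forall u, u \in P -> generates Sigma (P `\ u)].

Definition primitive_relation Sigma (P Q : {fset lattice d})
    (a : lattice d -> nat) : Prop :=
  primitive_collection Sigma P /\
  exists sigma : set NR,
    [/\ Sigma sigma,
        relint sigma (toNR R (\sum_(u <- P) u)),
        ray_gens sigma = [set` Q],
        forall v, v \in Q -> (0 < a v)%N
      & \sum_(u <- P) u = \sum_(v <- Q) v *+ a v].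

(* A numerical 1-cycle is given by its intersection numbers with the prime    *)
(* divisors D_u, u in G Sigma, extended by 0 to the lattice.                  *)
Definition relation_class (P Q : {fset lattice d}) (a : lattice d -> nat) :
    lattice d -> R :=
  fun u => (u \in P)%:R - (a u)%:R * (u \in Q)%:R.

(* b u = D_u . V(tau) for the invariant curve V(tau) of the wall              *)
(* tau = cone W, which separates the maximal cones spanned by W and y and by  *)
(* W and y' : the wall relation y + y' + \sum_(w in W) (b w) w = 0.  This is  *)
(* the intersection number when Sigma is smooth and complete.                 *)
Definition curve_class Sigma (W : {fset lattice d}) (b : lattice d -> int) :
    Prop :=
  exists y y' : lattice d,
  let A := y |` (y' |` W) in
  [/\ [/\ #|` W|.+1 = d, y != y', y \notin W & y' \notin W],
      forall u, u \in A -> G Sigma u,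
      generates Sigma (y |` W) /\ generates Sigma (y' |` W),
      [/\ b y = 1, b y' = 1 & forall u, u \notin A -> b u = 0]
    & \sum_(u <- A) b u *: u = 0].

(* The Kleiman-Mori cone, generated by the torus invariant curves.            *)
Definition NE Sigma : set (lattice d -> R) :=
  [set z | exists (n : nat) (W : 'I_n -> {fset lattice d})
             (b : 'I_n -> lattice d -> int) (c : 'I_n -> R),
     [/\ forall i, curve_class Sigma (W i) (b i),
         forall i, 0 <= c i
       & z = fun u => \sum_(i < n) c i * (b i u)%:~R]].

Definition on_ray (r z : lattice d -> R) : Prop :=
  exists2 c : R, 0 <= c & z = fun u => c * r u.

Definition extremal Sigma (r : lattice d -> R) : Prop :=
  [/\ NE Sigma r,
      exists u, r u != 0
    & forall x y, NE Sigma x -> NE Sigma y ->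
        on_ray r (fun u => x u + y u) -> on_ray r x /\ on_ray r y].

(* The identity of N induces a proper birational morphism from the toric      *)
(* variety of Sigma to that of Sigma'.                                        *)
Definition refines Sigma (Sigma' : fan R d) : Prop :=
  (forall sigma, Sigma sigma ->
     exists2 sigma', Sigma' sigma' & (sigma `<=` sigma')%classic) /\
  support Sigma = support Sigma'.

(* No prime divisor is contracted. *)
Definition small Sigma (Sigma' : fan R d) : Prop :=
  refines Sigma Sigma' /\ G Sigma = G Sigma'.

(* The orbit of tau maps onto the orbit of the smallest cone of Sigma'        *)
(* containing tau, which is a point when that cone is maximal.                *)
Definition contracted (Sigma' : fan R d) (tau : set NR) : Prop :=
  forall sigma', Sigma' sigma' -> (tau `<=` sigma')%classic ->
    maximal_cone Sigma' sigma'.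

(* The birational contraction of the ray spanned by r.                        *)
Definition contraction Sigma (r : lattice d -> R) (Sigmabar : fan R d) :
    Prop :=
  [/\ projective Sigmabar,
      refines Sigma Sigmabar
    & forall W b, curve_class Sigma W b ->
        (contracted Sigmabar (cone R W) <->
         on_ray r (fun u => (b u)%:~R))].

(* - K = \sum_(u in G Sigma) D_u *)
Definition anticanonical : lattice d -> int := fun=> 1.

Definition relatively_ample Sigma (Sigmabar : fan R d) a : Prop :=
  forall sigmabar, Sigmabar sigmabar -> ample_on Sigma a sigmabar.

Definition antiflip Sigma (r : lattice d -> R) (Sigmaplus : fan R d) : Prop :=
  exists Sigmabar : fan R d,
    [/\ contraction Sigma r Sigmabar,
        small Sigma Sigmabar,
        small Sigmaplus Sigmabar
      & relatively_ample Sigmaplus Sigmabar anticanonical].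

End Fans.

Definition minimal_in (T : choiceType) (F : set {fset T}) (A : {fset T}) :
    Prop :=
  F A /\ forall B, F B -> B `<=` A -> B = A.

(* Main.v *)
Require Import Defs.
From mathcomp Require Import all_boot all_order all_algebra.
From mathcomp Require Import finmap.
From mathcomp Require Import boolp classical_sets cardinality reals.
From mathcomp Require Import ring lra zify.

Set Implicit Arguments.
Unset Strict Implicit.
Unset Printing Implicit Defensive.

Import Order.TTheory GRing.Theory Num.Theory.

Local Open Scope classical_set_scope.
Local Open Scope fset_scope.
Local Open Scope ring_scope.

(** The proof identifies the fan of X^+ explicitly and then reads off its
    primitive collections.

    All computations take place in the maximal cones of Sigma, which are
    generated by lattice bases (basic_cone).  By basic_cone_cover these cones
    cover the space, and wall_crossing describes the wall relation between two
    neighbours.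

    Let sigma be a maximal cone of the contracted fan and F a maximal cone of
    Sigma inside it.  If some point of sigma has a negative coordinate with
    respect to F, then the corresponding facet of F lies in no proper face of
    sigma, so its curve is contracted and the wall relation is the given
    relation sum U = sum V (crossed_facet).  This yields the local structure of
    the contraction.  A maximal cone F that contains V misses exactly one vertex
    u of U, and exchanging u with any other vertex of U gives again a maximal
    cone (star_structure).  The rays in sigma are those of F, and those of U if
    F contains V (bar_cone_gens).

    Replacing in every such F a vertex v of V by the missing u gives, together
    with the maximal cones that do not contain V, a new family of unimodular
    cones that covers the space (flipped_cover).  On a new cone E the functional
    that is 1 on E has value |U| - |V| + 1 < 1 at the omitted vertex v
    (flipped_support); this is where |U| < |V| enters.  Since the anticanonical
    divisor of X^+ is relatively ample, its local equations can be compared with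
    these functionals, and the new cones turn out to be cones of Sigma^+
    (flipped_in_Splus).  The comparison uses that a strongly convex rational
    cone is generated by its extremal rays (cone_ray_gens), which rests on
    Farkas' lemma.  A fan that contains the new cones has no others but their faces;
    this proves smoothness and describes all faces (generates_SplusP).

    In combinatorial terms the star of V, which is the join of V, the boundary
    of U and the link of V, is replaced by the join of U, the boundary of V and
    the same link.  The minimal nonfaces of the result are computed in
    flipped_minimal_nonfaces.  Projectivity follows by adding a large multiple
    of an ample divisor of the base to the anticanonical divisor
    (relatively_ample_projective). *)

(** * Pairings and polyhedral cones *)

Section Pairing.
Variables (R : realFieldType) (d : nat).
Implicit Types (h x y : 'rV[R]_d) (u v : lattice d).

Lemma pairingE h x : pairing h x = \sum_j h 0 j * x 0 j.
Proof. by rewrite /pairing mxE; apply: eq_bigr => j _; rewrite mxE. Qed.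

Lemma pairingDr h x y : pairing h (x + y) = pairing h x + pairing h y.
Proof. by rewrite /pairing linearD mulmxDr mxE. Qed.

Lemma pairingZr h a x : pairing h (a *: x) = a * pairing h x.
Proof. by rewrite /pairing linearZ -scalemxAr mxE. Qed.

Lemma pairing0r h : pairing h 0 = 0.
Proof. by rewrite /pairing trmx0 mulmx0 mxE. Qed.

Lemma pairingNr h x : pairing h (- x) = - pairing h x.
Proof. by rewrite -scaleN1r pairingZr mulN1r. Qed.

Lemma pairingC h x : pairing h x = pairing x h.
Proof. by rewrite !pairingE; apply: eq_bigr => j _; rewrite mulrC. Qed.

Lemma pairingDl h h' x : pairing (h + h') x = pairing h x + pairing h' x.
Proof. by rewrite !(pairingC _ x) pairingDr. Qed.

Lemma pairingZl h a x : pairing (a *: h) x = a * pairing h x.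
Proof. by rewrite !(pairingC _ x) pairingZr. Qed.

Lemma pairing0l x : pairing 0 x = 0.
Proof. by rewrite pairingC pairing0r. Qed.

Lemma pairingNl h x : pairing (- h) x = - pairing h x.
Proof. by rewrite !(pairingC _ x) pairingNr. Qed.

Lemma pairing_sumr (I : Type) (s : seq I) (P : pred I) (f : I -> 'rV[R]_d) h :
  pairing h (\sum_(i <- s | P i) f i) = \sum_(i <- s | P i) pairing h (f i).
Proof.
by apply: (big_morph (pairing h)); [exact: pairingDr | exact: pairing0r].
Qed.

Lemma pairing_suml (I : Type) (s : seq I) (P : pred I) (f : I -> 'rV[R]_d) x :
  pairing (\sum_(i <- s | P i) f i) x = \sum_(i <- s | P i) pairing (f i) x.
Proof.
by rewrite pairingC pairing_sumr; apply: eq_bigr => i _; rewrite pairingC.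
Qed.

Lemma pairing_self_eq0 h : pairing h h = 0 -> h = 0.
Proof.
rewrite pairingE => /eqP; rewrite psumr_eq0 => [|j _]; last exact: sqr_ge0.
move=> /allP h0; apply/rowP => j; rewrite mxE.
have /implyP/(_ isT) := h0 j (mem_index_enum j).
by rewrite mulf_eq0 orbb => /eqP.
Qed.

Definition dotz u v : int := (u *m v^T) 0 0.

Lemma dotzE u v : dotz u v = \sum_j u 0 j * v 0 j.
Proof. by rewrite /dotz mxE; apply: eq_bigr => j _; rewrite mxE. Qed.

Lemma dotzDr u v w : dotz u (v + w) = dotz u v + dotz u w.
Proof. by rewrite /dotz linearD mulmxDr mxE. Qed.

Lemma dotzZr u a v : dotz u (a *: v) = a * dotz u v.
Proof. by rewrite /dotz linearZ -scalemxAr mxE. Qed.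

Lemma dotz0r u : dotz u 0 = 0.
Proof. by rewrite /dotz trmx0 mulmx0 mxE. Qed.

Lemma dotzC u v : dotz u v = dotz v u.
Proof. by rewrite !dotzE; apply: eq_bigr => j _; rewrite mulrC. Qed.

Lemma dotz_sumr (I : Type) (s : seq I) (P : pred I) (f : I -> lattice d) u :
  dotz u (\sum_(i <- s | P i) f i) = \sum_(i <- s | P i) dotz u (f i).
Proof. by apply: (big_morph (dotz u)); [exact: dotzDr | exact: dotz0r]. Qed.

Lemma toNRD u v : toNR R (u + v) = toNR R u + toNR R v.
Proof. exact: map_mxD. Qed.

Lemma toNR0 : toNR R (0 : lattice d) = 0.
Proof. exact: map_mx0. Qed.

Lemma toNRZ a u : toNR R (a *: u) = a%:~R *: toNR R u.
Proof. exact: map_mxZ. Qed.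

Lemma toNR_sum (I : Type) (s : seq I) (P : pred I) (f : I -> lattice d) :
  toNR R (\sum_(i <- s | P i) f i) = \sum_(i <- s | P i) toNR R (f i).
Proof. by apply: (big_morph (toNR R)); [exact: toNRD | exact: toNR0]. Qed.

Lemma toNR_inj : injective (@toNR R d).
Proof.
move=> u v /rowP e; apply/rowP => j; have := e j; rewrite !mxE.
exact: intr_inj.
Qed.

Lemma pairing_toNR u v : pairing (toNR R u) (toNR R v) = (dotz u v)%:~R.
Proof.
rewrite pairingE dotzE rmorph_sum; apply: eq_bigr => j _.
by rewrite !mxE rmorphM.
Qed.

End Pairing.

Section ConvexCones.
Variables (R : realFieldType) (d : nat).
Implicit Types (s t : seq (lattice d)) (sigma tau : set 'rV[R]_d).

Lemma cone0 s : cone R s 0.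
Proof.
exists (fun=> 0) => [u|]; first by [].
by rewrite big1 // => u _; rewrite scale0r.
Qed.

Lemma coneD s x y : cone R s x -> cone R s y -> cone R s (x + y).
Proof.
move=> [a a0 ->] [b b0 ->]; exists (fun u => a u + b u) => [u|].
  by rewrite addr_ge0.
by rewrite -big_split; apply: eq_bigr => u _; rewrite scalerDl.
Qed.

Lemma coneZ s a x : 0 <= a -> cone R s x -> cone R s (a *: x).
Proof.
move=> a0 [c c0 ->]; exists (fun u => a * c u) => [u|]; first by rewrite mulr_ge0.
by rewrite scaler_sumr; apply: eq_bigr => u _; rewrite scalerA.
Qed.

Lemma cone_sum s (I : Type) (r : seq I) (P : pred I) (f : I -> 'rV[R]_d) :
  (forall i, P i -> cone R s (f i)) -> cone R s (\sum_(i <- r | P i) f i).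
Proof.
move=> sf; elim/big_ind: _ => //; [exact: cone0 | exact: coneD].
Qed.

Lemma cone_gen s u : u \in s -> cone R s (toNR R u).
Proof.
move=> us; exists (fun v => (v == u)%:R / (count_mem v s)%:R) => [v|].
  by rewrite divr_ge0.
rewrite -(big_undup_iterop_count _ s) /=.
rewrite (bigD1_seq u) ?mem_undup ?undup_uniq //= big1 => [|v /negPf vu].
  rewrite addr0 eqxx -/(GRing.natmul _ _) -scaler_nat scalerA mul1r.
  rewrite mulfV ?scale1r //.
  by rewrite pnatr_eq0 -lt0n -has_count has_pred1.
by rewrite vu mul0r scale0r -/(GRing.natmul _ _) mul0rn.
Qed.

Lemma cone_sub s t :
  (forall u, u \in s -> cone R t (toNR R u)) -> (cone R s `<=` cone R t)%classic.
Proof.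
move=> st _ [c c0 ->]; rewrite big_seq; apply: cone_sum => u us.
by apply: coneZ => //; exact: st.
Qed.

Lemma subset_cone s t : {subset s <= t} -> (cone R s `<=` cone R t)%classic.
Proof. by move=> st; apply: cone_sub => u /st; exact: cone_gen. Qed.

Lemma eq_mem_cone s t : s =i t -> cone R s = cone R t.
Proof.
by move=> st; apply/seteqP; split; apply: subset_cone => u; rewrite st.
Qed.

Lemma pairing_cone_ge0 h s x : (forall u, u \in s -> 0 <= pairing h (toNR R u)) ->
  cone R s x -> 0 <= pairing h x.
Proof.
move=> hs [c c0 ->]; rewrite pairing_sumr big_seq sumr_ge0 // => u us.
by rewrite pairingZr mulr_ge0 ?hs.
Qed.

Lemma face_sub tau sigma : face tau sigma -> (tau `<=` sigma)%classic.
Proof. by move=> [h _ ->] x []. Qed.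

(** A sum of nonnegative numbers vanishes only termwise. *)
Lemma face_sum_all h s sigma (f : lattice d -> 'rV[R]_d) :
  (forall x, sigma x -> 0 <= pairing h x) ->
  (forall u, u \in s -> sigma (f u)) ->
  pairing h (\sum_(u <- s) f u) = 0 -> forall u, u \in s -> pairing h (f u) = 0.
Proof.
move=> hs fs /eqP; rewrite pairing_sumr big_seq psumr_eq0; last by move=> u /fs/hs.
by move=> /allP h0 u us; have /implyP/(_ us)/eqP := h0 u us.
Qed.

Lemma relint_sum_gens s : relint (cone R s) (toNR R (\sum_(u <- s) u)).
Proof.
rewrite toNR_sum; split.
  by rewrite big_seq; apply: cone_sum => u; exact: cone_gen.
move=> tau [h hs ->] [_ h0].
have hf := face_sum_all hs (fun u => @cone_gen s u) h0.
apply/seteqP; split=> [x []//|x xs]; split=> //.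
case: xs => c _ ->; rewrite pairing_sumr big_seq big1 // => u /hf.
by rewrite pairingZr => ->; rewrite mulr0.
Qed.

End ConvexCones.

(** * Lattice bases and simplicial cones *)

Section DualBases.
Variables (R : realFieldType) (d : nat).
Implicit Types (F S : {fset lattice d}) (D : lattice d -> lattice d).
Implicit Types (x y : 'rV[R]_d) (sigma tau : set 'rV[R]_d).

(** F is a basis of the lattice and D its dual family.  The equations refer to
    no enumeration of F, so they are easily carried through an exchange. *)
Definition dual_basis F D : Prop :=
  (forall f g, f \in F -> g \in F -> dotz (D f) g = (f == g)%:R) /\
  (forall x : lattice d, x = \sum_(f <- F) dotz (D f) x *: f).

Definition coord D (f : lattice d) x : R := pairing (toNR R (D f)) x.

Lemma coordD D f x y : coord D f (x + y) = coord D f x + coord D f y.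
Proof. exact: pairingDr. Qed.

Lemma coordZ D f a x : coord D f (a *: x) = a * coord D f x.
Proof. exact: pairingZr. Qed.

Lemma coordN D f x : coord D f (- x) = - coord D f x.
Proof. exact: pairingNr. Qed.

Lemma coord_sum D f (I : Type) (r : seq I) (P : pred I) (g : I -> 'rV[R]_d) :
  coord D f (\sum_(i <- r | P i) g i) = \sum_(i <- r | P i) coord D f (g i).
Proof. exact: pairing_sumr. Qed.

Lemma sum_fset_delta (K : choiceType) (A : {fset K}) (f : K) (c : K -> R) :
  \sum_(g <- A) c g * (f == g)%:R = (f \in A)%:R * c f.
Proof.
have [fA|fA] := boolP (f \in A); last first.
  rewrite big_seq big1 ?mul0r // => g gA; case: eqP => [e|]; last by rewrite mulr0.
  by rewrite e gA in fA.
rewrite (bigD1_seq f) //= eqxx mulr1 mul1r big1 ?addr0 // => g /negPf.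
by rewrite eq_sym => ->; rewrite mulr0.
Qed.

Section OneBasis.
Variables (F : {fset lattice d}) (D : lattice d -> lattice d).
Hypothesis FD : dual_basis F D.

Lemma coord_gen f g : f \in F -> g \in F -> coord D f (toNR R g) = (f == g)%:R.
Proof.
by move=> fF gF; rewrite /coord pairing_toNR FD.1 //; case: eqP.
Qed.

Lemma coord_lattice f u : coord D f (toNR R u) = (dotz (D f) u)%:~R.
Proof. exact: pairing_toNR. Qed.

Lemma coord_span x : x = \sum_(f <- F) coord D f x *: toNR R f.
Proof.
have eb (j : 'I_d) : \sum_(f <- F) ((D f) 0 j)%:~R *: toNR R f = delta_mx 0 j.
  have -> : delta_mx 0 j = toNR R (delta_mx 0 j).
    by rewrite /toNR map_delta_mx.
  rewrite (FD.2 (delta_mx 0 j)) toNR_sum; apply: eq_bigr => f _.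
  rewrite toNRZ dotzE (bigD1 j) //= big1 ?addr0 => [|i ij].
    by rewrite mxE !eqxx mulr1.
  by rewrite mxE (negPf ij) andbF mulr0.
rewrite {1}(row_sum_delta x).
under eq_bigr => j _ do rewrite -eb scaler_sumr.
rewrite exchange_big /=; apply: eq_bigr => f _.
rewrite /coord pairingE scaler_suml; apply: eq_bigr => j _.
by rewrite scalerA !mxE mulrC.
Qed.

Lemma coord_comb (A : {fset lattice d}) (c : lattice d -> R) f : A `<=` F ->
  f \in F ->
  coord D f (\sum_(g <- A) c g *: toNR R g) = (f \in A)%:R * c f.
Proof.
move=> AF fF; rewrite coord_sum -sum_fset_delta.
rewrite big_seq [RHS]big_seq; apply: eq_bigr => g gA.
by rewrite coordZ coord_gen // (fsubsetP AF).
Qed.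

Lemma coord_sum_gens (A : {fset lattice d}) f : A `<=` F -> f \in F ->
  coord D f (toNR R (\sum_(g <- A) g)) = (f \in A)%:R.
Proof.
move=> AF fF; rewrite toNR_sum -[RHS]mulr1 -(coord_comb (fun=> 1)) //.
by congr (coord _ _ _); apply: eq_bigr => g _; rewrite scale1r.
Qed.

Lemma dotz_sum_gens (A : {fset lattice d}) f : A `<=` F -> f \in F ->
  dotz (D f) (\sum_(g <- A) g) = (f \in A)%:R.
Proof.
move=> AF fF; apply/eqP; rewrite -(eqr_int R) -coord_lattice coord_sum_gens //.
by case: (_ \in _).
Qed.

Lemma cone_coordP S x : S `<=` F ->
  cone R S x <-> (forall f, f \in S -> 0 <= coord D f x) /\
                 (forall f, f \in F -> f \notin S -> coord D f x = 0).
Proof.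
move=> SF; split=> [[c c0 ->]|[x0 x1]].
  split=> f fS; first by rewrite coord_comb ?(fsubsetP SF) // fS mul1r.
  by move=> /negPf fS'; rewrite coord_comb // fS' mul0r.
exists (fun f => if f \in S then coord D f x else 0) => [f|].
  by case: ifP => // /x0.
rewrite {1}(coord_span x) (big_fsetID _ (mem S)) /=.
rewrite [X in _ + X]big_seq [X in _ + X]big1 ?addr0.
  have -> : [fset f in F | f \in S] = S.
    apply/fsetP => f; rewrite !inE /=; apply: andb_idl => fS.
    exact: (fsubsetP SF).
  by rewrite big_seq [RHS]big_seq; apply: eq_bigr => f ->.
by move=> f; rewrite !inE /= => /andP[fF fS]; rewrite x1 // scale0r.
Qed.

Lemma basis_coneP x : cone R F x <-> forall f, f \in F -> 0 <= coord D f x.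
Proof.
rewrite cone_coordP //; split=> [[] //|x0]; split=> // f fF.
by rewrite fF.
Qed.

Lemma notin_basis_cone x : ~ cone R F x -> exists2 f, f \in F & coord D f x < 0.
Proof.
move=> nx; apply: contrapT => /forall2NP nf; apply: nx; apply/basis_coneP => f fF.
by case: (nf f) => // /negP; rewrite -leNgt.
Qed.

(** The coordinates outside S add up to a functional that exposes the face. *)
Lemma face_subset S S' : S `<=` S' -> S' `<=` F -> face (cone R S) (cone R S').
Proof.
move=> SS' S'F; exists (\sum_(f <- S' `\` S) toNR R (D f)) => [x|].
  move/(cone_coordP _ S'F) => [x0 _].
  rewrite pairing_suml big_seq sumr_ge0 // => f; rewrite !inE => /andP[_ /x0].
  exact.
apply/seteqP; split=> x.
  move=> xS; have [x0 x1] := (cone_coordP x (fsubset_trans SS' S'F)).1 xS.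
  split; first by apply: subset_cone xS; exact/fsubsetP.
  rewrite pairing_suml big_seq big1 // => f; rewrite !inE => /andP[fS fS'].
  by apply: x1 => //; exact: (fsubsetP S'F).
move=> [xS' hx]; have [x0 x1] := (cone_coordP x S'F).1 xS'.
apply/(cone_coordP x (fsubset_trans SS' S'F)); split=> [f fS|f fF fS].
  by apply: x0; exact: (fsubsetP SS').
have [fS'|fS'] := boolP (f \in S'); last exact: x1.
move: hx => /eqP; rewrite pairing_suml big_seq psumr_eq0; last first.
  by move=> g; rewrite !inE => /andP[_ /x0].
by move=> /allP/(_ f); rewrite !inE fS fS' /= => /(_ isT)/eqP.
Qed.

Lemma basis_vector_primitive f : f \in F -> primitive_vector f.
Proof.
move=> fF; have e : dotz (D f) f = 1 by rewrite FD.1 // eqxx.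
split=> [|k w fw]; first by apply/eqP => f0; rewrite f0 dotz0r in e.
move: e; rewrite {2}fw dotzZr => e.
move/(congr1 absz): e; rewrite abszM => /eqP; rewrite muln_eq1.
by move=> /andP[/eqP k1 _]; lia.
Qed.

(** The factor a is the coordinate of u at f, hence an integer; as u is
    primitive, it is 1. *)
Lemma primitive_basis_ray f u (a : R) : f \in F -> 0 <= a ->
  primitive_vector u -> toNR R u = a *: toNR R f -> u = f.
Proof.
move=> fF a0 [_ up] e.
have ea : (dotz (D f) u)%:~R = a.
  by rewrite -coord_lattice e coordZ coord_gen // eqxx mulr1.
have uf : u = dotz (D f) u *: f by apply: (@toNR_inj R); rewrite toNRZ ea.
case: (up _ _ uf) => k; first by rewrite uf k scale1r.
by move: a0; rewrite -ea k rmorphN1 oppr_ge0 ler10.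
Qed.

Lemma pairing_eq0 h : (forall f, f \in F -> pairing h (toNR R f) = 0) ->
  forall x, pairing h x = 0.
Proof.
move=> h0 x; rewrite (coord_span x) pairing_sumr big_seq big1 // => f /h0.
by rewrite pairingZr => ->; rewrite mulr0.
Qed.

Lemma pairing_gens_inj h h' :
  (forall f, f \in F -> pairing h (toNR R f) = pairing h' (toNR R f)) -> h = h'.
Proof.
move=> e; apply/eqP; rewrite -subr_eq0; apply/eqP/pairing_self_eq0.
by apply: pairing_eq0 => f /e; rewrite pairingDl pairingNl => ->; rewrite subrr.
Qed.

(** The matrices of F and of its dual family are inverse to each other on both
    sides, so they are square. *)
Lemma card_dual_basis : #|` F| = d.
Proof.
pose B := \matrix_(i < size F) F`_i.
pose C := \matrix_(j < d, i < size F) D F`_i 0 j.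
have BC : B *m C = 1%:M.
  apply/matrixP => i k; rewrite !mxE.
  transitivity (dotz (D F`_k) F`_i).
    by rewrite dotzE; apply: eq_bigr => j _; rewrite !mxE mulrC.
  by rewrite FD.1 ?mem_nth // nth_uniq // eq_sym.
have CB : C *m B = 1%:M.
  apply/matrixP => j k; have /rowP/(_ k) := FD.2 (delta_mx 0 j).
  rewrite !mxE eqxx /= [k == j]eq_sym => ->.
  rewrite summxE (big_nth 0) big_mkord; apply: eq_bigr => i _.
  rewrite !mxE dotzE (bigD1 j) //= big1 ?addr0 => [|l lj].
    by rewrite mxE !eqxx mulr1.
  by rewrite mxE (negPf lj) andbF mulr0.
by apply/eqP; rewrite eqn_leq (mulmx1_min BC) (mulmx1_min CB).
Qed.

Lemma dual_basis_matrix S : S `<=` F -> exists (B : 'M[int]_d) (I : {set 'I_d}),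
  B \in unitmx /\ cone R S = cone R [seq row i B | i <- enum I].
Proof.
move=> SF; have sF : size F = d := card_dual_basis.
pose B : 'M[int]_d := \matrix_(i < d) F`_i.
pose C : 'M[int]_d := \matrix_(j < d, i < d) D F`_i 0 j.
have BC : B *m C = 1%:M.
  apply/matrixP => i k; rewrite !mxE.
  transitivity (dotz (D F`_k) F`_i).
    by rewrite dotzE; apply: eq_bigr => j _; rewrite !mxE mulrC.
  by rewrite FD.1 ?mem_nth ?sF // nth_uniq ?sF // eq_sym.
exists B, (finset (fun i : 'I_d => F`_i \in S)); split.
  by case: (mulmx1_unit BC).
apply: eq_mem_cone => u; apply/idP/mapP.
  move=> uS; have uF := fsubsetP SF _ uS.
  have iu : (index u F < d)%N by rewrite -[X in (_ < X)%N]sF index_mem.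
  exists (Ordinal iu); first by rewrite mem_enum inE /= nth_index.
  by rewrite rowK /= nth_index.
by move=> [i]; rewrite mem_enum inE rowK => iS ->.
Qed.

(** D v takes the value 1 on the new vector u as well; the other functionals are
    made to vanish on u by subtracting integral multiples of D v. *)
Lemma dual_basis_swap u v : v \in F -> u \notin F -> dotz (D v) u = 1 ->
  exists D', dual_basis (u |` (F `\ v)) D'.
Proof.
move=> vF uF Dvu.
have uv : u != v by apply: contraNneq uF => ->.
exists (fun f => if f == u then D v else D f - dotz (D f) u *: D v); split.
  move=> f g; rewrite !inE => /predU1P[->|/andP[fv fF]];
    move=> /predU1P[->|/andP[gv gF]]; rewrite ?eqxx.
  - by [].
  - rewrite FD.1 // [v == g]eq_sym (negPf gv); case: eqP => // e.
    by rewrite -e (negPf uF) in gF.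
  - have -> : (f == u) = false by apply/eqP => e; rewrite -e fF in uF.
    rewrite dotzC dotzDr -scaleNr dotzZr ![dotz u _]dotzC Dvu.
    by rewrite mulr1 subrr.
  - have -> : (f == u) = false by apply/eqP => e; rewrite -e fF in uF.
    rewrite dotzC dotzDr -scaleNr dotzZr ![dotz g _]dotzC FD.1 //.
    by rewrite (FD.1 v) // [v == g]eq_sym (negPf gv) mulr0 addr0.
move=> x; rewrite big_fsetU1 /=; last by rewrite !inE (negPf uF) andbF.
rewrite eqxx.
have -> : \sum_(f <- F `\ v)
    dotz (if f == u then D v else D f - dotz (D f) u *: D v) x *: f =
  \sum_(f <- F `\ v) (dotz (D f) x *: f) -
  dotz (D v) x *: \sum_(f <- F `\ v) (dotz (D f) u *: f).
  rewrite scaler_sumr -sumrB big_seq [RHS]big_seq; apply: eq_bigr => f.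
  rewrite !inE => /andP[fv fF].
  have -> : (f == u) = false by apply/eqP => e; rewrite -e fF in uF.
  rewrite dotzC dotzDr -scaleNr dotzZr ![dotz x _]dotzC scalerA -scalerBl.
  by congr (_ *: _); rewrite mulNr mulrC.
have eu := FD.2 u; rewrite (big_fsetD1 v vF) /= Dvu scale1r in eu.
rewrite {1}(FD.2 x) (big_fsetD1 v vF) /= [X in _ = _ *: X + _]eu scalerDr.
by rewrite -!addrA; congr (_ + _); rewrite addrC addrNK.
Qed.

End OneBasis.

(** The dual family consists of the columns of the inverse matrix. *)
Lemma unitmx_dual_basis (B : 'M[int]_d) (I : {set 'I_d}) : B \in unitmx ->
  exists F D S, [/\ dual_basis F D, S `<=` F &
    cone R [seq row i B | i <- enum I] = cone R S].
Proof.
move=> Bu; pose A := invmx B.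
have BA : B *m A = 1%:M by exact: mulmxV.
have AB : A *m B = 1%:M by exact: mulVmx.
have BAij i j : dotz (col j A)^T (row i B) = (i == j)%:R.
  rewrite dotzE -[RHS]/((nat_of_bool (i == j))%:R).
  have /matrixP/(_ i j) := BA; rewrite !mxE => <-.
  by apply: eq_bigr => k _; rewrite !mxE mulrC.
have rinj : injective (fun i => row i B).
  move=> i j e; have := BAij i j; rewrite e BAij eqxx.
  by case: eqP => // _ /eqP.
pose D f := if [pick i | row i B == f] is Some i then (col i A)^T else 0.
have DB i : D (row i B) = (col i A)^T.
  rewrite /D; case: pickP => [j /eqP/rinj -> //|/(_ i)]; by rewrite eqxx.
exists [fset row i B | i in 'I_d], D, [fset row i B | i in I]; split.
- split=> [f g /imfsetP[i /= _ ->] /imfsetP[j /= _ ->]|x].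
    by rewrite DB BAij (inj_eq rinj) eq_sym.
  rewrite big_imfset /=; last by move=> i j _ _; exact: rinj.
  rewrite -{1}(mulmx1 x) -AB mulmxA mulmx_sum_row big_enum /=.
  apply: eq_bigr => i _; rewrite DB; congr (_ *: _).
  by rewrite dotzE !mxE; apply: eq_bigr => k _; rewrite !mxE mulrC.
- by apply/fsubsetP => f /imfsetP[i /= _ ->]; apply/imfsetP; exists i.
- apply: eq_mem_cone => u; apply/mapP/imfsetP => -[i iI ->]; exists i => //.
    by move: iI; rewrite mem_enum.
  by rewrite mem_enum.
Qed.

End DualBases.

(** * Farkas' lemma and generation by rays *)

Section Farkas.
Variables (R : realFieldType) (d : nat).
Implicit Types (s : seq 'rV[R]_d) (x y a b k : 'rV[R]_d).

(** The convex cone generated by s, in the form that an induction on the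
    generators takes apart. *)
Fixpoint conic s x : Prop :=
  if s is a :: s' then exists2 c, 0 <= c & conic s' (x - c *: a) else x = 0.

(** Lifts a combination of projected generators back along the direction k of
    the projection. *)
Lemma conic_shift s (p : 'rV[R]_d -> R) k x :
  (forall a, a \in s -> 0 <= p a) ->
  conic [seq a + p a *: k | a <- s] x ->
  exists2 t, 0 <= t & conic s (x - t *: k).
Proof.
elim: s x => [|a s IH] x ps /=; first by move=> ->; exists 0; rewrite ?scale0r ?subr0.
move=> [c c0 /IH[b bs|t t0 xt]]; first by apply: ps; rewrite inE bs orbT.
have pa : 0 <= p a by apply: ps; rewrite inE eqxx.
exists (t + c * p a); first by rewrite addr_ge0 // mulr_ge0.
exists c => //; congr (conic s _): xt.
rewrite scalerDr scalerDl scalerA !opprD !addrA.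
by rewrite -!addrA; congr (_ + _); rewrite addrC -addrA addrCA.
Qed.

(** Bartl's induction on the generators: either the functional h0 that separates
    b from the smaller cone is also nonnegative on the new generator e, or
    everything is projected along e to the kernel of h0. *)
Lemma farkas s b : conic s b \/
  exists2 h, (forall a, a \in s -> 0 <= pairing h a) & pairing h b < 0.
Proof.
elim: {s}(size s) {-2}s (erefl (size s)) b => [|n IH] [|e s] //= sz b.
  have [->|b0] := eqVneq b 0; [by left | right].
  exists (- b) => //; rewrite pairingNl oppr_lt0 lt_neqAle eq_sym.
  apply/andP; split; first by apply: contraNneq b0 => /pairing_self_eq0 ->.
  by rewrite pairingE sumr_ge0 // => j _; rewrite sqr_ge0.
case: sz => sz.
have [bs|[h0 h0s h0b]] := IH s sz b.
  by left; exists 0 => //; rewrite scale0r subr0.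
have [h0e|h0e] := leP 0 (pairing h0 e).
  by right; exists h0 => // a /predU1P[->|/h0s].
pose p a := - pairing h0 a / pairing h0 e.
have pD h a : pairing h (a + p a *: e) =
    pairing (h - (pairing h e / pairing h0 e) *: h0) a.
  rewrite pairingDr pairingDl pairingNl !pairingZr pairingZl /p; ring.
have sz' : size [seq a + p a *: e | a <- s] = n by rewrite size_map.
have [cb|[h hs hb]] := IH _ sz' (b + p b *: e).
- left; have [a /h0s a0|t t0 st] := conic_shift _ cb.
    by rewrite /p mulNr -mulrN mulr_ge0 // oppr_ge0 invr_le0 ltW.
  exists (t - p b); last by rewrite scalerBl opprB addrA.
  by rewrite addr_ge0 // /p mulNr opprK mulr_le0 // ?invr_le0 ltW.
- right; exists (h - (pairing h e / pairing h0 e) *: h0); last by rewrite -pD.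
  move=> a /predU1P[->|as']; last by rewrite -pD; apply: hs; exact: map_f.
  by rewrite pairingDl pairingNl pairingZl divfK ?subrr // ltr0_neq0.
Qed.

End Farkas.

Section RayGeneration.
Variables (R : realFieldType) (d : nat).
Implicit Types (s t : seq (lattice d)) (e u : lattice d).

(** Dividing a vector by a factor other than 1 and -1 decreases the sum of the
    absolute values of its entries. *)
Lemma primitive_on_ray e : e != 0 ->
  exists w, primitive_vector w /\ cone R [:: e] = cone R [:: w].
Proof.
have [n] := ubnP (\sum_j absz (e 0%R j))%N.
elim: n e => // n IH e; rewrite ltnS => en e0.
have [|np] := pselect (primitive_vector e); first by exists e.
have : exists k w, e = k *: w /\ ~ (k = 1 \/ k = -1).
  apply: contrapT => H; apply: np; split=> // k w ekw; apply: contrapT => nk.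
  by apply: H; exists k, w.
move=> [k [w [ekw nk]]].
have k0 : k != 0 by apply: contraNneq e0 => k0; rewrite ekw k0 scale0r.
pose w' := (if 0 < k then w else - w).
have ew : e = `|k| *: w'.
  rewrite /w'; case: (ltrP 0 k) => kp; first by rewrite gtr0_norm.
  by rewrite ler0_norm // scaleNr scalerN opprK.
have w0 : w' != 0 by apply: contraNneq e0 => w0; rewrite ew w0 scaler0.
have kp : 0 < `|k|%:~R :> R by rewrite ltr0z normr_gt0.
have [|//|w2 [pw2 cw2]] := IH w'.
  apply: leq_trans en.
  have [j wj] : exists j, w' 0 j != 0.
    apply: contrapT => nw; case/eqP: w0; apply/rowP => j; rewrite mxE.
    by apply/eqP/negPn/negP => wj; apply: nw; exists j.
  rewrite (bigD1 j) //= [X in (_ < X)%N](bigD1 j) //=.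
  have k1 : (1 < `|k|)%N by move: k0 nk; lia.
  rewrite -addSn leq_add //; last first.
    by apply: leq_sum => i _; rewrite ew mxE -abszE abszM leq_pmull // ltnW.
  by rewrite ew mxE -abszE abszM ltn_Pmull // absz_gt0.
exists w2; split=> //; rewrite -cw2 ew; apply/seteqP; split; apply: cone_sub => u.
  rewrite inE => /eqP ->; rewrite toNRZ; apply: coneZ; first exact: ltW.
  by apply: cone_gen; rewrite inE.
rewrite inE => /eqP ->.
have -> : toNR R w' = (`|k|%:~R)^-1 *: toNR R (`|k| *: w').
  by rewrite toNRZ scalerA mulVf ?scale1r // gt_eqF.
apply: coneZ; first by rewrite invr_ge0 ltW.
by apply: cone_gen; rewrite inE.
Qed.

Lemma conic_cone s x : conic [seq toNR R u | u <- s] x -> cone R s x.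
Proof.
elim: s x => [|u s IH] x /=; first by move=> ->; exact: cone0.
move=> [c c0 /IH xs]; rewrite -(subrK (c *: toNR R u) x) addrC.
apply: coneD; first by apply: coneZ => //; apply: cone_gen; rewrite inE eqxx.
by apply: subset_cone xs => v vs; rewrite inE vs orbT.
Qed.

Lemma cone_rem s e x : e \in s -> cone R s x ->
  exists2 c, 0 <= c & cone R (rem e s) (x - c *: toNR R e).
Proof.
move=> es [c c0 ->]; exists (c e) => //.
rewrite (big_rem e es) /= addrAC subrr add0r big_seq; apply: cone_sum => u us.
by apply: coneZ => //; exact: cone_gen.
Qed.

(** For each other generator a there is a functional that is nonnegative on the
    cone, zero at e and positive at a; the sum of these exposes the ray of e.
    Otherwise, by Farkas' lemma, - a would be a combination of the other
    generators and a multiple of e, so that e would be redundant or the cone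
    would contain a line. *)
Lemma irredundant_face s e : strongly_convex (cone R s) ->
  (forall a, a \in s -> ~ cone R (rem a s) (toNR R a)) -> e \in s ->
  face (cone R [:: e]) (cone R s).
Proof.
move=> sc irr es; set s' := rem e s.
have s's : {subset s' <= s} by exact: mem_rem.
have sep a : a \in s' -> exists h, [/\ pairing h (toNR R e) = 0,
    forall u, u \in s' -> 0 <= pairing h (toNR R u) & 0 < pairing h (toNR R a)].
  move=> as'; have := farkas (toNR R e :: - toNR R e :: [seq toNR R u | u <- s'])
    (- toNR R a).
  case=> [[l l0 [m m0]]|[h hs]]; last first.
    rewrite pairingNr oppr_lt0 => ha; exists h; split=> // [|u us].
      have := hs (toNR R e); rewrite inE eqxx => /(_ isT) h1.
      have := hs (- toNR R e); rewrite !inE eqxx orbT => /(_ isT).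
      by rewrite pairingNr oppr_ge0 => h2; apply/eqP; rewrite eq_le h1 h2.
    by apply: hs; rewrite !inE map_f ?orbT.
  move/conic_cone; set z := (X in cone R s' X) => zs.
  have az : toNR R a + z = (m - l) *: toNR R e.
    by rewrite /z scalerBl scalerN opprK !addrA subrr add0r addrC.
  have [ml|ml] := ltP l m.
    case: (irr e es); rewrite -/s'.
    have ml0 : m - l != 0 by rewrite gt_eqF // subr_gt0.
    have -> : toNR R e = (m - l)^-1 *: (toNR R a + z).
      by rewrite az scalerA mulVf // scale1r.
    apply: coneZ; first by rewrite invr_ge0 subr_ge0 ltW.
    by apply: coneD => //; exact: cone_gen.
  case: (irr a (s's _ as')); suff -> : toNR R a = 0 by exact: cone0.
  apply: sc; first by apply: cone_gen; exact: s's.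
  have -> : - toNR R a = z + (l - m) *: toNR R e.
    by rewrite -[l - m]opprB scaleNr -az opprD addrCA subrr addr0.
  apply: coneD; first exact: subset_cone zs.
  by apply: coneZ; [rewrite subr_ge0 | exact: cone_gen].
have [h [he hs hp]] : exists h, [/\ pairing h (toNR R e) = 0,
    forall u, u \in s' -> 0 <= pairing h (toNR R u) &
    forall a, a \in s' -> 0 < pairing h (toNR R a)].
  suff [h [he hs hp]] : exists h, [/\ pairing h (toNR R e) = 0,
    forall u, u \in s' -> 0 <= pairing h (toNR R u) &
    forall a, a \in s' -> a \in s' -> 0 < pairing h (toNR R a)].
    by exists h; split=> // a as'; exact: hp.
  move: {2}(s'); elim=> [|b l [h [he hs hp]]].
    by exists 0; split=> [|u _|]; rewrite ?pairing0l.
  have [bs|bs] := boolP (b \in s'); last first.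
    by exists h; split=> // a /predU1P[->|/hp //]; rewrite (negPf bs).
  have [h' [h'e h's h'b]] := sep b bs.
  exists (h + h'); split=> [|u us|a /predU1P[->|al] as'];
    rewrite pairingDl ?he ?h'e ?addr0 //.
  - by rewrite addr_ge0 ?hs ?h's.
  - by rewrite ltr_wpDl ?hs.
  - by rewrite ltr_pwDl ?hp ?h's.
have ge0 x : cone R s x -> 0 <= pairing h x.
  apply: pairing_cone_ge0 => u us; have [->|ue] := eqVneq u e; first by rewrite he.
  apply: hs; apply/negPn/negP => us'; case/negP: ue.
  by have := us; rewrite (perm_mem (perm_to_rem es)) inE -/s' (negPf us') orbF.
exists h => //; apply/seteqP; split=> x.
  move=> [c c0 ->]; rewrite big_seq1; split.
    by apply: coneZ => //; exact: cone_gen.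
  by rewrite pairingZr he mulr0.
move=> [xs hx]; have [c c0 [k k0 e1]] := cone_rem es xs.
have xe : x = c *: toNR R e + \sum_(u <- s') k u *: toNR R u.
  by rewrite -e1 addrC subrK.
have /eqP : \sum_(u <- s') pairing h (k u *: toNR R u) = 0.
  by rewrite -pairing_sumr -e1 pairingDr pairingNr pairingZr hx he mulr0 subr0.
rewrite big_seq psumr_eq0 => [/allP k1|u us]; last by rewrite pairingZr mulr_ge0 ?hs.
rewrite xe big_seq big1 ?addr0 => [|u us].
  by apply: coneZ => //; apply: cone_gen; rewrite inE.
have /implyP/(_ us) := k1 u us; rewrite pairingZr mulf_eq0.
rewrite [X in _ || X]gt_eqF ?hp // orbF.
by move=> /eqP ->; rewrite scale0r.
Qed.

(** Minkowski's theorem: once redundant generators are removed one by one, the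
    remaining ones span the extremal rays. *)
Lemma cone_ray_gens s : strongly_convex (cone R s) ->
  exists2 t, (forall u, u \in t -> ray_gens (cone R s) u) & cone R s = cone R t.
Proof.
have [n] := ubnP (size s); elim: n s => // n IH s; rewrite ltnS => sn sc.
have [[a as1 ar]|nr] := pselect (exists2 a, a \in s & cone R (rem a s) (toNR R a)).
  have e : cone R s = cone R (rem a s).
    apply/seteqP; split; last exact/subset_cone/mem_rem.
    apply: cone_sub => u; rewrite (perm_mem (perm_to_rem as1)) inE.
    by move=> /predU1P[->//|]; exact: cone_gen.
  rewrite e in sc *; apply: IH => //; rewrite size_rem //.
  by case: (s) as1 sn.
have irr a : a \in s -> ~ cone R (rem a s) (toNR R a).
  by move=> as1 ar; apply: nr; exists a.
have ex e : e \in s -> exists w, ray_gens (cone R s) w /\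
    cone R [:: e] = cone R [:: w].
  move=> es; have e0 : e != 0.
    by apply/eqP => e0; apply: (irr e es); rewrite e0 toNR0; exact: cone0.
  have [w [pw ew]] := primitive_on_ray e0.
  by exists w; split=> //; split=> //; rewrite -ew; exact: irredundant_face.
pose w e := if pselect (exists w, ray_gens (cone R s) w /\
    cone R [:: e] = cone R [:: w]) is left P then projT1 (cid P) else 0.
have wP e : e \in s -> ray_gens (cone R s) (w e) /\
    cone R [:: e] = cone R [:: w e].
  by move=> /ex es; rewrite /w; case: pselect => // P; case: (cid P).
exists [seq w e | e <- s]; first by move=> u /mapP[e /wP[? _] ->].
apply/seteqP; split; apply: cone_sub => u.
  move=> us; have [_ e] := wP u us.
  have : cone R [:: w u] (toNR R u) by rewrite -e; apply: cone_gen; rewrite inE.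
  apply: subset_cone => v; rewrite inE => /eqP ->; exact: map_f.
move=> /mapP[e es ->]; have [_ ee] := wP e es.
have : cone R [:: e] (toNR R (w e)) by rewrite ee; apply: cone_gen; rewrite inE.
by apply: subset_cone => v; rewrite inE => /eqP ->.
Qed.

End RayGeneration.
Lemma finite_maximal_above (T : Type) (P : set (set T)) (A : set T) :
  finite_set P -> P A ->
  exists2 B, P B /\ (A `<=` B)%classic &
    forall C, P C -> (B `<=` C)%classic -> C = B.
Proof.
move=> /(finite_seqP (P : set (set T : choiceType)))[s ->].
have [n] := ubnP (size s); elim: n s A => // n IH s A; rewrite ltnS => sn As.
have [[C [Cs AC CA]]|nC] :=
  pselect (exists C, [/\ C \in s, (A `<=` C)%classic & C <> A]); last first.
  exists A; first by split.
  move=> C Cs AC; apply: contrapT => CA; apply: nC; by exists C.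
pose s' := [seq B <- s | B != A].
have Cs' : C \in s' by rewrite mem_filter Cs andbT; apply/eqP.
have s'n : (size s' < n)%N.
  apply: leq_trans sn; rewrite size_filter ltn_neqAle count_size andbT.
  by rewrite -all_count; apply/allPn; exists A => //; rewrite eqxx.
have [B [Bs' CB] Bmax] := IH s' C s'n Cs'.
have AB : (A `<=` B)%classic by apply: subset_trans CB.
have Bs : B \in s by move: Bs'; rewrite /= mem_filter => /andP[].
exists B; first by split.
move=> E Es BE; apply: Bmax => //=; rewrite mem_filter Es andbT.
apply/eqP => EA; apply: CA; apply/seteqP; split=> //.
by rewrite -EA; apply: subset_trans BE.
Qed.

(** * Fans and their unimodular full-dimensional cones *)

Section Fans.
Variables (R : realFieldType) (d : nat) (Sigma : fan R d).
Implicit Types (F S P : {fset lattice d}) (D : lattice d -> lattice d).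
Implicit Types (sigma tau : set 'rV[R]_d) (u : lattice d).

Lemma fan_seq : exists s : seq (set 'rV[R]_d),
  forall sigma, sigma \in s <-> Sigma sigma.
Proof.
have /(finite_seqP (Sigma : set (set 'rV[R]_d : choiceType)))[s es] :=
  fan_finite Sigma.
by exists s => sigma; rewrite -[Sigma _]/((Sigma : set _) sigma) es.
Qed.

Lemma fan_sub_face sigma tau : Sigma sigma -> Sigma tau ->
  (tau `<=` sigma)%classic -> face tau sigma.
Proof.
move=> ss st ts; have [+ _] := fan_inter ss st.
suff -> : (sigma `&` tau)%classic = tau by [].
by apply/seteqP; split=> [x []//|x tx]; split=> //; exact: ts.
Qed.

Lemma maximal_cone_above sigma : Sigma sigma ->
  exists2 tau, maximal_cone Sigma tau & (sigma `<=` tau)%classic.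
Proof.
move=> ss; have [B [SB sB] Bmax] := finite_maximal_above (fan_finite Sigma) ss.
by exists B => //; split=> // tau tS Bt; exact: Bmax.
Qed.

Lemma ray_gensP sigma u : Sigma sigma ->
  ray_gens sigma u <-> G Sigma u /\ sigma (toNR R u).
Proof.
move=> ss; split=> [[pu fu]|[[pu Su] su]].
  split; first by split=> //; exact: fan_face fu.
  by apply: (face_sub fu); apply: cone_gen; rewrite inE.
split=> //; apply: fan_sub_face => //.
have [s es] := fan_polyhedral ss; rewrite es in su *.
by apply: cone_sub => v; rewrite inE => /eqP ->.
Qed.

(** The sum of the generators is a relative interior point, and a face through
    such a point is the whole cone. *)
Lemma cone_generators_sub s tau : Sigma (cone R s) -> Sigma tau ->
  tau (\sum_(u <- s) toNR R u) -> (cone R s `<=` tau)%classic.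
Proof.
move=> Ss St tx; have [[h hs e] _] := fan_inter Ss St.
have sx : cone R s (\sum_(u <- s) toNR R u).
  by rewrite big_seq; apply: cone_sum => u; exact: cone_gen.
have [_ h0] : [set x | cone R s x /\ pairing h x = 0]%classic
    (\sum_(u <- s) toNR R u) by rewrite -e.
have hf := face_sum_all hs (fun u => @cone_gen R d s u) h0.
move=> x xs; have [] : (cone R s `&` tau)%classic x; last by [].
rewrite e; split=> //; case: xs => c _ ->.
rewrite pairing_sumr big_seq big1 // => u /hf.
by rewrite pairingZr => ->; rewrite mulr0.
Qed.

Section Spanning.
Variables (F : {fset lattice d}) (D : lattice d -> lattice d).
Hypothesis FD : dual_basis F D.

Lemma spanning_cone_sub sigma tau : Sigma sigma -> Sigma tau ->
  (forall f, f \in F -> sigma (toNR R f)) -> tau (\sum_(f <- F) toNR R f) ->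
  (sigma `<=` tau)%classic.
Proof.
move=> ss st Fs tx; have [[h hs e] _] := fan_inter ss st.
have sx : sigma (\sum_(f <- F) toNR R f).
  have [s es] := fan_polyhedral ss; rewrite es in Fs *.
  by rewrite big_seq; apply: cone_sum.
have [_ h0] : [set x | sigma x /\ pairing h x = 0]%classic
    (\sum_(f <- F) toNR R f) by rewrite -e.
have hf := face_sum_all hs Fs h0.
move=> x xs; have [] : (sigma `&` tau)%classic x; last by [].
by rewrite e; split=> //; exact: (pairing_eq0 FD).
Qed.

Lemma spanning_cone_maximal sigma : Sigma sigma ->
  (forall f, f \in F -> sigma (toNR R f)) -> maximal_cone Sigma sigma.
Proof.
move=> ss Fs; split=> // tau st stau; apply/seteqP; split=> //.
apply: spanning_cone_sub => // [f /Fs/stau //|].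
have [s es] := fan_polyhedral ss; rewrite es in Fs *.
by rewrite big_seq; apply: cone_sum.
Qed.

End Spanning.

(** In a smooth complete fan these are the maximal cones. *)
Definition basic_cone F : Prop :=
  (exists D, dual_basis F D) /\ Sigma (cone R F).

Lemma basic_cone_face F S : basic_cone F -> S `<=` F -> Sigma (cone R S).
Proof.
by move=> [[D FD] sF] SF; apply: fan_face sF _; exact: (face_subset R FD).
Qed.

Lemma basic_cone_G F u : basic_cone F -> u \in F -> G Sigma u.
Proof.
move=> bF uF; have [[D FD] _] := bF.
split; first exact: (basis_vector_primitive FD).
rewrite (@eq_mem_cone _ _ [:: u] [fset u]); last by move=> v; rewrite !inE.
by apply: basic_cone_face bF _; rewrite fsub1set.
Qed.

(** The ray of u is a face of every cone of the fan that contains u.  The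
    functional exposing it vanishes at the generators that occur in u, so that
    such a generator lies on the ray of u. *)
Lemma basic_cone_gens F S u : basic_cone F -> S `<=` F -> G Sigma u ->
  cone R S (toNR R u) -> u \in S.
Proof.
move=> bF SF Gu Fu; have [[D FD] sF] := bF; have [pu su] := Gu.
have sS := basic_cone_face bF SF.
have [u0 u1] := (cone_coordP FD _ SF).1 Fu.
have [_ [h hF e]] := (ray_gensP _ sS).2 (conj Gu Fu).
have hu : pairing h (toNR R u) = 0.
  have : cone R [:: u] (toNR R u) by apply: cone_gen; rewrite inE.
  by rewrite e => -[].
have [f fF fu] : exists2 f, f \in F & coord D f (toNR R u) != 0.
  apply: contrapT => /forall2NP nf; case: pu => /eqP u0' _; apply: u0'.
  apply: (@toNR_inj R); rewrite toNR0 (coord_span FD (toNR R u)).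
  rewrite big_seq big1 // => f fF.
  by case: (nf f) => // /negP; rewrite negbK => /eqP ->; rewrite scale0r.
have fS : f \in S by apply/negPn/negP => fS; rewrite u1 ?eqxx in fu.
have hf : pairing h (toNR R f) = 0.
  move/eqP: hu; rewrite (coord_span FD (toNR R u)) pairing_sumr.
  rewrite (big_fsetID _ (mem S)) /= [X in _ + X]big_seq [X in _ + X]big1; last first.
    by move=> g; rewrite !inE /= => /andP[gF gS]; rewrite u1 // scale0r pairing0r.
  rewrite addr0 big_seq psumr_eq0; last first.
    move=> g; rewrite !inE /= => /andP[gF gS]; rewrite pairingZr.
    by rewrite mulr_ge0 ?u0 // hF //; exact: cone_gen.
  move=> /allP/(_ f); rewrite !inE fF fS pairingZr mulf_eq0 (negPf fu) /=.
  by move=> /(_ isT)/eqP.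
have : cone R [:: u] (toNR R f) by rewrite e; split=> //; exact: cone_gen.
move=> [c c0]; rewrite big_seq1 => ef.
suff -> : u = f by [].
have c1 : c u != 0.
  apply/eqP => c1; have := coord_gen R FD fF fF; rewrite ef c1 eqxx coordZ mul0r.
  by move/eqP; rewrite eq_sym oner_eq0.
apply: (primitive_basis_ray FD fF (a := (c u)^-1)) => //; first by rewrite invr_ge0.
by rewrite ef scalerA mulVf // scale1r.
Qed.

Lemma ray_gens_basic F S : basic_cone F -> S `<=` F ->
  ray_gens (cone R S) = [set` S].
Proof.
move=> bF SF; have sS := basic_cone_face bF SF.
apply/seteqP; split=> u /=.
  by move=> /(ray_gensP _ sS)[Gu Su]; exact: basic_cone_gens bF SF Gu Su.
move=> uS; apply/(ray_gensP _ sS); split; last exact: cone_gen.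
by apply: basic_cone_G bF _; exact: (fsubsetP SF).
Qed.

Lemma basic_cone_sub F P : basic_cone F -> generates Sigma P ->
  (forall u, u \in P -> G Sigma u) ->
  cone R F (\sum_(u <- P) toNR R u) -> P `<=` F.
Proof.
move=> bF sP GP xF; apply/fsubsetP => u uP.
apply: (basic_cone_gens bF) => //; first exact: GP.
by apply: (cone_generators_sub sP bF.2 xF); exact: cone_gen.
Qed.

Lemma basic_cone_eq F F' : basic_cone F -> basic_cone F' -> F `<=` F' -> F = F'.
Proof.
move=> [[D FD] _] [[D' FD'] _] FF'; apply/eqP; rewrite eqEfcard FF' /=.
by rewrite (card_dual_basis FD) (card_dual_basis FD').
Qed.

Section Cover.
Variable C : {fset lattice d} -> Prop.
Hypothesis basicC : forall F, C F -> basic_cone F.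
Hypothesis coverC : forall x, exists2 F, C F & cone R F x.

(** The sum of P lies in some cone of the cover, which then contains P. *)
Lemma cover_generatesP P : (forall u, u \in P -> G Sigma u) ->
  generates Sigma P <-> exists2 F, C F & P `<=` F.
Proof.
move=> GP; split=> [sP|[F /basicC bF PF]]; last exact: basic_cone_face bF PF.
have [F CF Fx] := coverC (\sum_(u <- P) toNR R u).
by exists F => //; exact: basic_cone_sub (basicC CF) _ _ _.
Qed.

Lemma cover_face_of_basic sigma : Sigma sigma ->
  exists F S, [/\ C F, S `<=` F & sigma = cone R S].
Proof.
move=> ss; have [s es] := fan_polyhedral ss; rewrite es in ss *.
have [F CF Fx] := coverC (\sum_(u <- s) toNR R u).
have [[D FD] sF] := basicC CF.
have sub := cone_generators_sub ss sF Fx.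
have [h hF e] := fan_sub_face sF ss sub.
exists F, [fset f in F | pairing h (toNR R f) == 0]; split=> //.
  by apply/fsubsetP => f; rewrite !inE => /andP[].
apply/seteqP; split=> x.
  move=> xs; have xF := sub _ xs.
  apply/(cone_coordP FD).
    by apply/fsubsetP => f; rewrite !inE => /andP[].
  have x0 := (basis_coneP FD x).1 xF.
  split=> [f|f fF]; first by rewrite !inE => /andP[fF _]; exact: x0.
  rewrite !inE fF /= => hf.
  move: xs; rewrite e => -[_ /eqP]; rewrite {1}(coord_span FD x) pairing_sumr.
  rewrite big_seq psumr_eq0 => [/allP/(_ f fF)|g gF].
    by rewrite fF pairingZr mulf_eq0 (negPf hf) orbF => /eqP.
  by rewrite pairingZr mulr_ge0 ?x0 // hF //; exact: cone_gen.
rewrite e => -[c c0 ->]; split.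
  rewrite big_seq; apply: cone_sum => f; rewrite !inE => /andP[fF _].
  by apply: coneZ => //; exact: cone_gen.
rewrite pairing_sumr big_seq big1 // => f; rewrite !inE pairingZr.
by move=> /andP[_ /eqP ->]; rewrite mulr0.
Qed.

Lemma cover_smooth : smooth Sigma.
Proof.
move=> sigma /cover_face_of_basic[F [S [CF SF ->]]].
have [[D FD] _] := basicC CF; exact: (dual_basis_matrix R FD).
Qed.

End Cover.
End Fans.

(** * Smooth complete fans: covering and wall crossing *)

Section SmallParameters.
Variable R : realFieldType.
Implicit Types (P Q : R -> Prop) (a b t : R).

(** The property holds for all small positive parameters.  Limits are only taken
    along segments. *)
Definition near0 P : Prop := exists2 e, 0 < e & forall t, 0 < t -> t <= e -> P t.

Lemma near0_ex P : near0 P -> exists2 t, 0 < t & P t.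
Proof. by move=> [e e0 Pe]; exists e => //; exact: Pe. Qed.

Lemma near0_imp P Q : (forall t, 0 < t -> P t -> Q t) -> near0 P -> near0 Q.
Proof. by move=> PQ [e e0 Pe]; exists e => // t t0 te; apply: PQ => //; exact: Pe. Qed.

Lemma near0_all (T : eqType) (s : seq T) (P : T -> R -> Prop) :
  (forall i, i \in s -> near0 (P i)) -> near0 (fun t => forall i, i \in s -> P i t).
Proof.
elim: s => [|i s IH] sP; first by exists 1.
have [|e e0 Pe] := IH; first by move=> j js; apply: sP; rewrite inE js orbT.
have [|e' e'0 Pe'] := sP i; first by rewrite inE eqxx.
exists (Num.min e e'); first by rewrite lt_min e0.
move=> t t0; rewrite le_min => /andP[te te'] j /predU1P[->|js]; first exact: Pe'.
exact: Pe.
Qed.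

Lemma near0_affine_lt a b : a < 0 -> near0 (fun t => a + t * b < 0).
Proof.
move=> a0; have b1 : 0 < `|b| + 1 by rewrite ltr_wpDl.
exists (- a / (`|b| + 1)); first by rewrite divr_gt0 // oppr_gt0.
move=> t t0; rewrite ler_pdivlMr // => tb.
have : t * b <= t * `|b| by rewrite ler_pM2l // ler_norm.
by move: tb; rewrite mulrDr mulr1 => h1 h2; lra.
Qed.

Lemma near0_affine_neq a b : (a != 0) || (b != 0) ->
  near0 (fun t => a + t * b != 0).
Proof.
have [a0|a0|->] := ltgtP a 0 => /= b0.
- by apply: near0_imp (near0_affine_lt b a0) => t _ /ltr0_neq0.
- have : - a < 0 by rewrite oppr_lt0.
  move=> /(near0_affine_lt (- b)); apply: near0_imp => t _.
  by rewrite mulrN -opprD oppr_lt0 => /lt0r_neq0.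
- by exists 1 => // t t0 _; rewrite add0r mulf_neq0 // gt_eqF.
Qed.

End SmallParameters.

Section SmoothCompleteFans.
Variables (R : realFieldType) (d : nat) (Sigma : fan R d).
Hypothesis Ssmooth : smooth Sigma.
Implicit Types (F : {fset lattice d}) (sigma : set 'rV[R]_d) (x y h : 'rV[R]_d).

Lemma smooth_cone sigma : Sigma sigma ->
  exists F D S, [/\ dual_basis F D, S `<=` F & sigma = cone R S].
Proof.
move=> /Ssmooth[B [I [Bu ->]]].
by have [F [D [S [FD SF e]]]] := unitmx_dual_basis R I Bu; exists F, D, S.
Qed.

(** A unimodular cone is given by weak inequalities between coordinates. *)
Lemma smooth_cone_closed sigma x y : Sigma sigma -> ~ sigma x ->
  near0 (fun t => ~ sigma (x + t *: y)).
Proof.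
move=> /smooth_cone[F [D [S [FD SF ->]]]] nx.
have [[f fS fx]|nS] := pselect (exists2 f, f \in S & coord D f x < 0).
  apply: near0_imp (near0_affine_lt (coord D f y) fx) => t t0 ft /(cone_coordP FD _ SF).
  by move=> [/(_ f fS)]; rewrite coordD coordZ leNgt ft.
have [[f fF [fS fx]]|nF] :=
    pselect (exists2 f, f \in F & f \notin S /\ coord D f x != 0).
  have := @near0_affine_neq _ (coord D f x) (coord D f y); rewrite fx => /(_ isT).
  apply: near0_imp => t t0 ft /(cone_coordP FD _ SF)[_ /(_ f fF fS)].
  by rewrite coordD coordZ => /eqP; rewrite (negPf ft).
case: nx; apply/(cone_coordP FD _ SF); split=> [f fS|f fF fS].
  by rewrite leNgt; apply/negP => fx; apply: nS; exists f.
by apply/eqP/negPn/negP => fx; apply: nF; exists f.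
Qed.

Lemma smooth_cone_flat sigma : Sigma sigma ->
  (exists2 F, basic_cone Sigma F & sigma = cone R F) \/
  (exists2 h, h != 0 & forall x, sigma x -> pairing h x = 0).
Proof.
move=> ss; have [F [D [S [FD SF e]]]] := smooth_cone ss.
have [SF'|SneF] := eqVneq S F.
  by left; exists F; rewrite -?SF' //; split; [exists D; rewrite SF' | rewrite -e].
right; have [f fF fS] : exists2 f, f \in F & f \notin S.
  apply: contrapT => /forall2NP nf; case/negP: SneF.
  rewrite eqEfsubset SF /=; apply/fsubsetP => f fF.
  by case: (nf f) => // /negP/negPn.
exists (toNR R (D f)) => [|x]; last first.
  by rewrite e => /(cone_coordP FD _ SF)[_]; exact.
apply/eqP => f0; have := coord_gen R FD fF fF.
by rewrite /coord f0 pairing0l eqxx => /eqP; rewrite eq_sym oner_eq0.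
Qed.

(** A direction that is generic for the tail stays so when it is moved slightly
    towards h. *)
Lemma generic_direction (s : seq 'rV[R]_d) : (forall h, h \in s -> h != 0) ->
  exists y, forall h, h \in s -> pairing h y != 0.
Proof.
elim: s => [|h s IH] s0; first by exists 0.
have [|y ys] := IH; first by move=> k ks; apply: s0; rewrite inE ks orbT.
have h0 : pairing h h != 0.
  by apply/eqP => /pairing_self_eq0/eqP; rewrite (negPf (s0 h _)) // inE eqxx.
have [|t _ ts] := near0_ex (@near0_all _ _ (h :: s)
    (fun k t => pairing k y + t * pairing k h != 0) _).
  move=> k /predU1P[->|ks]; apply: near0_affine_neq; first by rewrite h0 orbT.
  by rewrite ys.
by exists (y + t *: h) => k /ts; rewrite pairingDr pairingZr.
Qed.

Hypothesis Scomplete : complete Sigma.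

(** The cones of smaller dimension lie in finitely many hyperplanes, and a
    generic segment issued from x avoids these near x.  Hence a
    full-dimensional cone contains points of the segment close to x; being
    closed, it contains x. *)
Lemma basic_cone_cover x : exists2 F, basic_cone Sigma F & cone R F x.
Proof.
have [s sS] := fan_seq Sigma.
pose hs sigma h := h != 0 /\ forall x, sigma x -> pairing h x = 0.
pose hh sigma : 'rV[R]_d :=
  if pselect (exists h, hs sigma h) is left P then projT1 (cid P) else 0.
have hhP sigma : (exists h, hs sigma h) -> hs sigma (hh sigma).
  by rewrite /hh; case: pselect => // P _; case: (cid P).
have [|y ys] := @generic_direction [seq h <- map hh s | h != 0].
  by move=> h; rewrite mem_filter => /andP[].
apply: contrapT => nF.
have H sigma : sigma \in s -> near0 (fun t => ~ sigma (x + t *: y)).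
  move=> ss; have sS' := (sS sigma).1 ss.
  have [[F bF e]|[h h0 hsg]] := smooth_cone_flat sS'.
    by apply: smooth_cone_closed => // sx; apply: nF; exists F; rewrite -?e.
  have [k0 ks] := hhP sigma (ex_intro _ h (conj h0 hsg)).
  have := @near0_affine_neq _ (pairing (hh sigma) x) (pairing (hh sigma) y).
  rewrite ys ?orbT; last by rewrite mem_filter k0 map_f.
  move=> /(_ isT); apply: near0_imp => t t0 /eqP + /ks.
  by rewrite pairingDr pairingZr.
have [t _ ts] := near0_ex (near0_all H).
have : Defs.support Sigma (x + t *: y) by rewrite Scomplete.
by move=> [sigma /sS ss]; exact: ts.
Qed.

Lemma basic_cone_germ x y : exists F t,
  [/\ basic_cone Sigma F, 0 < t, cone R F x & cone R F (x + t *: y)].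
Proof.
have [s sS] := fan_seq Sigma.
have H sigma : sigma \in [seq sigma <- s | `[< ~ sigma x >]] ->
    near0 (fun t => ~ sigma (x + t *: y)).
  by rewrite mem_filter => /andP[/asboolP nx /sS ss]; exact: smooth_cone_closed.
have [t t0 ts] := near0_ex (near0_all H).
have [F bF Fx] := basic_cone_cover (x + t *: y).
exists F, t; split=> //; apply: contrapT => nx; apply: (ts (cone R F)) => //.
rewrite mem_filter; apply/andP; split; first exact/asboolP.
by apply/sS; exact: bF.2.
Qed.

(** The neighbouring cone is met when the cone of F is left through the middle
    of its facet opposite to f.  By unimodularity the coordinate of f at f' is
    1 or - 1, and it is negative since f' lies beyond the facet; so the wall
    relation begins with f + f'. *)
Lemma wall_crossing F f : basic_cone Sigma F -> f \in F ->
  exists f' b, [/\ f' \notin F, basic_cone Sigma (f' |` (F `\ f)),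
    curve_class Sigma (F `\ f) b, b f = 1 /\ b f' = 1 &
    forall u, u \notin f' |` F -> b u = 0].
Proof.
move=> bF fF; have [[D FD] _] := bF.
set W := F `\ f; have WF : W `<=` F by exact: fsubD1set.
have fW : f \notin W by rewrite !inE eqxx.
have [F' [t [bF' t0 xF' yF']]] :=
  basic_cone_germ (\sum_(w <- W) toNR R w) (- toNR R f).
have [[D' FD'] _] := bF'.
have WF' : W `<=` F'.
  apply: (basic_cone_sub bF') xF'; first exact: basic_cone_face bF WF.
  by move=> u uW; apply: (basic_cone_G bF); exact: (fsubsetP WF).
have fF' : f \notin F'.
  apply/negP => fF'.
  have FF' : F = F'.
    apply: (basic_cone_eq bF bF'); apply/fsubsetP => u uF.
    have [->//|uf] := eqVneq u f; apply: (fsubsetP WF').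
    by rewrite !inE uf.
  have := (basis_coneP FD' _).1 yF' f fF'.
  rewrite coordD coordZ coordN -toNR_sum (coord_sum_gens R FD' WF') //.
  rewrite (negPf fW) add0r (coord_gen R FD') // eqxx mulrN1 oppr_ge0.
  by rewrite leNgt t0.
have cW : (#|` W|.+1 = d)%N.
  by rewrite -[RHS](card_dual_basis FD) (cardfsD1 f F) fF.
have [f' f'F' f'W] : exists2 f', f' \in F' & f' \notin W.
  apply: contrapT => /forall2NP nf.
  suff : F' `<=` W.
    move=> /fsubset_leq_card; rewrite leqNgt.
    by rewrite (card_dual_basis FD') -[X in (_ < X)%N]cW ltnSn.
  by apply/fsubsetP => u uF'; case: (nf u) => // /negP/negPn.
have f'F : f' \notin F.
  apply/negP => f'F; move: f'W; rewrite !inE f'F andbT negbK => /eqP e.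
  by rewrite -e f'F' in fF'.
have eF' : F' = f' |` W.
  apply/esym/eqP; rewrite eqEfcard fsubUset fsub1set f'F' WF' /=.
  by rewrite (card_dual_basis FD') cardfsU1 f'W /= add1n cW.
have ff' : f != f' by apply: contraNneq fF' => ->.
have sum' (v : lattice d) :
    v = dotz (D' f') v *: f' + \sum_(w <- W) dotz (D' w) v *: w.
  by rewrite {1}(FD'.2 v) eF' big_fsetU1.
have c1 : dotz (D' f') f * dotz (D f) f' = 1.
  have := FD.1 f f fF fF; rewrite eqxx {2}(sum' f) dotzDr dotzZr dotz_sumr.
  rewrite big_seq big1 ?addr0 // => w wW.
  rewrite dotzZr (FD.1 _ _ fF (fsubsetP WF _ wW)).
  by case: eqP => [e|]; [rewrite -e (negPf fW) in wW | rewrite mulr0].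
have c0 : dotz (D' f') f <= 0.
  have := (basis_coneP FD' _).1 yF' f' f'F'.
  rewrite coordD coordZ coordN -toNR_sum (coord_sum_gens R FD' WF') //.
  rewrite (negPf f'W) add0r coord_lattice mulrN oppr_ge0 pmulr_rle0 //.
  by rewrite lerz0.
have cN1 : dotz (D' f') f = -1.
  have /eqP := congr1 absz c1; rewrite abszM muln_eq1.
  by move=> /andP[/eqP k1 _]; lia.
pose b u := if (u == f) || (u == f') then 1 else
            if u \in W then - dotz (D' u) f else 0.
have bf : b f = 1 by rewrite /b eqxx.
have bf' : b f' = 1 by rewrite /b eqxx orbT.
exists f', b; split=> //; first by rewrite -eF'.
  exists f, f'; split=> //.
  - move=> u; rewrite !inE => /orP[/eqP ->|/orP[/eqP ->|/andP[_ uF]]].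
    + exact: basic_cone_G bF fF.
    + exact: basic_cone_G bF' f'F'.
    + exact: basic_cone_G bF uF.
  - rewrite /generates -eF' fsetD1K //; by split; [exact: bF.2 | exact: bF'.2].
  - split=> // u; rewrite !inE !negb_or => /and3P[uf uf' uF].
    by rewrite /b (negPf uf) (negPf uf') /= !inE (negPf uF).
  - rewrite big_fsetU1 /=; last by rewrite !inE negb_or ff' eqxx.
    rewrite big_fsetU1 //= bf bf' !scale1r {1}(sum' f) cN1 scaleN1r.
    rewrite [X in _ + (_ + X)](_ : _ = - \sum_(w <- W) dotz (D' w) f *: w).
      by rewrite addrACA subrr addr0 addNr.
    rewrite -sumrN big_seq [RHS]big_seq; apply: eq_bigr => w wW.
    rewrite /b wW; case: eqP => [e|_]; first by rewrite -e wW in fW.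
    by case: eqP => [e|_ /=]; [rewrite -e wW in f'W | rewrite scaleNr].
move=> u; rewrite !inE negb_or => /andP[uf' uF].
rewrite /b (negPf uf') !inE (negPf uF) andbF orbF.
by case: eqP => // e; rewrite e fF in uF.
Qed.

End SmoothCompleteFans.

(** * Minimal nonfaces of a flipped simplicial complex *)

Section FlippedComplex.
Variables (K : choiceType) (vertex : K -> Prop) (face face' : {fset K} -> Prop).
Variables U V : {fset K}.
Implicit Types P Q A B S T : {fset K}.

Definition minimal_nonface (fc : {fset K} -> Prop) P : Prop :=
  [/\ P != fset0, forall u, u \in P -> vertex u, ~ fc P
    & forall u, u \in P -> fc (P `\ u)].

Hypothesis face_sub : forall A B, A `<=` B -> face B -> face A.
Hypothesis UV0 : forall u, u \in U -> u \in V -> False.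
Hypothesis V0 : V != fset0.
Hypothesis vertexV : forall v, v \in V -> vertex v.
Hypothesis faceV : face V.
Hypothesis primU : minimal_nonface face U.
(* The star of V is the join of V, the boundary of the simplex U and the link
   of V.  In face' it is replaced by the join of U, the boundary of V and the
   same link. *)
Hypothesis star : forall B u, face (V `|` B) -> u \in U ->
  (forall w, w \in B -> w \in U -> False) -> face ((V `|` B) `|` (U `\ u)).
Hypothesis face'P : forall P, (forall u, u \in P -> vertex u) ->
  face' P <-> ~ (V `<=` P) /\ (face P \/ (U `<=` P /\ face (V `|` (P `\` U)))).

Lemma face0 : face fset0.
Proof. exact: face_sub (fsub0set V) faceV. Qed.

Lemma nonface_minimal P : (forall u, u \in P -> vertex u) -> ~ face P ->
  exists2 Q, minimal_nonface face Q & Q `<=` P.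
Proof.
have [n] := ubnP #|` P|; elim: n P => // n IH P; rewrite ltnS => Pn vP nP.
have [[u uP nPu]|H] := pselect (exists2 u, u \in P & ~ face (P `\ u)); last first.
  exists P => //; split=> // [|u uP].
    by apply/eqP => P0; apply: nP; rewrite P0; exact: face0.
  by apply: contrapT => nPu; apply: H; exists u.
have [||//|Q pQ QP] := IH (P `\ u).
- by apply: leq_trans Pn; rewrite [X in (_ < X)%N](cardfsD1 u) uP.
- by move=> w; rewrite !inE => /andP[_ /vP].
- by exists Q => //; apply: fsubset_trans QP (fsubD1set _ _).
Qed.

Lemma face_not_minimal P Q : face P -> minimal_nonface face Q -> ~ (Q `<=` P).
Proof. by move=> fP [_ _ nQ _] QP; apply: nQ; exact: face_sub fP. Qed.

Lemma minimal_nonface_eq P Q : minimal_nonface face P -> minimal_nonface face Q ->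
  Q `<=` P -> Q = P.
Proof.
move=> [_ _ _ Pf] pQ QP; apply/eqP; rewrite eqEfsubset QP /=.
apply/fsubsetP => u uP; apply/negPn/negP => uQ.
apply: (face_not_minimal (Pf u uP) pQ); apply/fsubsetP => w wQ.
rewrite !inE (fsubsetP QP) // andbT; apply: contraNneq uQ => <-; exact: wQ.
Qed.

Lemma nsubsetP A B : ~ (A `<=` B) -> exists2 a, a \in A & a \notin B.
Proof.
move=> nAB; apply: contrapT => /forall2NP H; apply: nAB; apply/fsubsetP => a aA.
by case: (H a) => // /negP/negPn.
Qed.

Let vertexU u : u \in U -> vertex u.
Proof. by case: primU => _ + _ _; exact. Qed.

Lemma disjoint_not_supset P : (forall u, u \in P -> u \in V -> False) -> ~ (V `<=` P).
Proof.
move=> PV VP; have /fset0Pn[v vV] := V0.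
exact: (PV v (fsubsetP VP _ vV) vV).
Qed.

(** The minimal traces off V are the minimal nonfaces of the link of V.  Such a
    trace B avoids U: otherwise V and B \ U would still span no face, for else
    the star condition, applied to a vertex of U off B, would make V and B span
    one; then B \ U would be a smaller trace. *)
Lemma minimal_trace_link B :
  minimal_in [set A | exists Q', [/\ minimal_nonface face Q',
    Q' `&` V <> fset0 & A = Q' `\` V]] B ->
  [/\ forall u, u \in B -> vertex u, forall u, u \in B -> u \in V -> False,
      forall u, u \in B -> u \in U -> False, ~ face (V `|` B) &
      forall u, u \in B -> face (V `|` (B `\ u))].
Proof.
move=> [[Q [pQ QV eB]] Bmin].
have vB u : u \in B -> vertex u.
  by rewrite eB inE => /andP[_]; case: pQ => _ + _ _; exact.
have BV u : u \in B -> u \in V -> False.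
  by rewrite eB inE => /andP[/negPf ->].
have QVB : Q `<=` V `|` B.
  by rewrite eB; apply/fsubsetP => u uQ; rewrite !inE uQ andbT orbN.
have nVB : ~ face (V `|` B) by move=> /face_not_minimal/(_ pQ).
have fB : face B.
  have [v] : exists v, v \in Q `&` V by apply/fset0Pn/eqP.
  rewrite !inE => /andP[vQ vV]; have [_ _ _ /(_ v vQ)] := pQ.
  apply: face_sub; rewrite eB; apply/fsubsetP => u; rewrite !inE => /andP[uV ->].
  by rewrite andbT; apply: contraNneq uV => ->.
have sub A : A `<=` B -> ~ face (V `|` A) -> A = B.
  move=> AB nA; have [|T pT TA] := nonface_minimal _ nA.
    move=> u; rewrite inE => /orP[/vertexV //|uA]; exact/vB/(fsubsetP AB).
  have TVA : T `\` V `<=` A.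
    apply/fsubsetP => u; rewrite !inE => /andP[uV /(fsubsetP TA)].
    by rewrite inE (negPf uV).
  have e : T `\` V = B.
    apply: Bmin; last exact: fsubset_trans AB.
    exists T; split=> // TV0; apply: (face_not_minimal fB pT).
    apply/fsubsetP => u uT; apply: (fsubsetP AB); apply: (fsubsetP TVA).
    rewrite !inE uT andbT; apply/negP => uV.
    by have : u \in T `&` V; [rewrite inE uT | rewrite TV0 inE].
  by apply/eqP; rewrite eqEfsubset AB -e.
have BU u : u \in B -> u \in U -> False.
  move=> uB uU; have : ~~ (U `<=` B).
    by apply/negP => UB; have [_ _ nU _] := primU; apply: nU; exact: face_sub fB.
  move=> /fsubsetPn[w wU wB].
  have nBU : ~ face (V `|` (B `\` U)).
    move=> fBU; apply: nVB.
    have : face ((V `|` (B `\` U)) `|` (U `\ w)).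
      by apply: star => // a; rewrite !inE => /andP[/negPf ->].
    apply: face_sub; apply/fsubsetP => a; rewrite !inE => /orP[->//|aB].
    rewrite aB andbT; have [aU|aU] := boolP (a \in U); last by rewrite orbT.
    by rewrite orbC /= andbT (_ : a != w) //; apply: contraNneq wB => <-.
  have := sub _ (fsubsetDl B U) nBU => /fsetP/(_ u).
  by rewrite !inE uB uU.
split=> // u uB; apply: contrapT => nu.
by have := sub _ (fsubD1set _ _) nu => /fsetP/(_ u); rewrite !inE eqxx uB.
Qed.

(** A minimal nonface P of the new complex other than V does not contain V.  If
    it does not contain U either, it is an old minimal nonface, since faces
    that contain neither U nor V are the same for both complexes.  If it
    contains U, then its vertices in V are superfluous, and P \ U is a minimal
    nonface of the link of V; this is where the third family comes from. *)
Lemma flipped_minimal_nonfaces P :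
  minimal_nonface face' P <->
  [\/ P = V,
      [/\ minimal_nonface face P, ~ (V `<=` P) & P <> U]
    | exists Q, [/\ minimal_nonface face Q,
        minimal_in [set A | exists Q', [/\ minimal_nonface face Q',
           Q' `&` V <> fset0 & A = Q' `\` V]] (Q `\` V),
        forall S, S `<` U -> ~ exists T, minimal_nonface face T /\
           T `<=` (Q `\` V) `|` S
      & P = (Q `\` V) `|` U]].
Proof.
have [_ _ nfU fU] := primU.
have vD A B : (forall u, u \in A -> vertex u) -> forall u, u \in A `\` B -> vertex u.
  by move=> vA u; rewrite inE => /andP[_ /vA].
have vD1 A a : (forall u, u \in A -> vertex u) -> forall u, u \in A `\ a -> vertex u.
  by move=> vA u; rewrite !inE => /andP[_ /vA].
split=> [[P0 vP nP Pf]|].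
  have [->|PV] := eqVneq P V; first by constructor 1.
  have nVP : ~ (V `<=` P).
    move=> VP; have [u uP uV] : exists2 u, u \in P & u \notin V.
      apply: nsubsetP => PV'; case/eqP: PV; apply/eqP.
      by rewrite eqEfsubset PV' VP.
    have /(face'P (vD1 _ _ vP))[+ _] := Pf u uP; apply.
    apply/fsubsetP => v vV; rewrite !inE (fsubsetP VP) // andbT.
    by apply: contraNneq uV => <-.
  have nfP : ~ face P by move=> fP; apply: nP; apply/face'P => //; split=> //; left.
  have [T pT TP] := nonface_minimal vP nfP.
  have [UP|UP] := pselect (U `<=` P); last first.
    constructor 2; suff <- : T = P.
      split=> // [VT|TU]; first exact/nVP/(fsubset_trans VT).
      by apply: UP; rewrite -TU.
    apply/eqP; rewrite eqEfsubset TP /=; apply/fsubsetP => u uP.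
    apply/negPn/negP => uT; have /(face'P (vD1 _ _ vP))[_ []] := Pf u uP.
      move=> /face_not_minimal/(_ pT); apply; apply/fsubsetP => w wT.
      rewrite !inE (fsubsetP TP) // andbT; apply: contraNneq uT => <-; exact: wT.
    by move=> [UPu _]; apply: UP; apply: fsubset_trans UPu (fsubD1set _ _).
  constructor 3; pose B := P `\` (U `|` V).
  have eVB : V `|` (P `\` U) = V `|` B.
    apply/fsetP => u; rewrite !inE negb_or; case: (u \in V) => //=.
    by rewrite andbT.
  have nVB : ~ face (V `|` B).
    rewrite -eVB => fB; apply: nP; apply/face'P => //; split=> //; right; by split.
  have PB : P = B `|` U.
    (* A vertex of P in V could be dropped without making P a face. *)
    apply/fsetP => u; rewrite !inE negb_or.
    have [uU|uU] /= := boolP (u \in U); first by rewrite (fsubsetP UP).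
    rewrite orbF; have [uV|//] := boolP (u \in V); apply/negP => uP.
    have /(face'P (vD1 _ _ vP))[_ H] := Pf u uP.
    apply: nVB; case: H => [fP|[_]].
      case: nfU; apply: face_sub fP; apply/fsubsetP => w wU.
      rewrite !inE (fsubsetP UP) // andbT; apply: contraNneq uU => <-; exact: wU.
    apply: face_sub; apply/fsubsetP => w; rewrite !inE negb_or.
    move=> /orP[->//|/andP[/andP[-> wV] ->]]; rewrite andbT /=.
    by apply/orP; right; apply: contraNneq wV => ->.
  have BU u : u \in B -> u \in U -> False.
    by rewrite !inE negb_or => /andP[/andP[/negPf ->]].
  have BV u : u \in B -> u \in V -> False.
    by rewrite !inE negb_or => /andP[/andP[_ /negPf ->]].
  have vB u : u \in B -> vertex u by exact: vD.
  have fB b : b \in B -> face (V `|` (B `\ b)).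
    move=> bB; have bP : b \in P by rewrite PB inE bB.
    have /(face'P (vD1 _ _ vP))[_ [fP|[_]]] := Pf b bP.
      case: nfU; apply: face_sub fP; apply/fsubsetP => w wU.
      rewrite !inE (fsubsetP UP) // andbT; apply/eqP => wb.
      by apply: (BU b) => //; rewrite -wb.
    apply: face_sub; apply/fsubsetP => w; rewrite !inE negb_or.
    by move=> /orP[->//|/andP[-> /andP[/andP[-> _] ->]]]; rewrite orbT.
  have fBU u : u \in U -> face (B `|` (U `\ u)).
    move=> uU; have /(face'P (vD1 _ _ vP))[_ [fP|[UPu _]]] := Pf u (fsubsetP UP _ uU).
      apply: face_sub fP; apply/fsubsetP => w wBU.
      have wP : w \in P.
        rewrite PB inE; move: wBU; rewrite inE => /orP[->//|].
        by rewrite inE => /andP[_ ->]; rewrite orbT.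
      rewrite 2!inE wP andbT; move: wBU; rewrite inE => /orP[wB|].
        by apply/eqP => wu; apply: (BU u) => //; rewrite -wu.
      by rewrite 2!inE => /andP[].
    by have := fsubsetP UPu _ uU; rewrite !inE eqxx.
  have [|Q pQ QVB] := nonface_minimal _ nVB.
    by move=> u; rewrite inE => /orP[/vertexV|/vB].
  have fBB : face B.
    have /fset0Pn[u uU] : U != fset0 by case: primU.
    by apply: face_sub (fBU u uU); exact: fsubsetUl.
  have tr T' : minimal_nonface face T' -> T' `\` V `<=` B -> T' `\` V = B.
    move=> pT' T'B; apply/eqP; rewrite eqEfsubset T'B /=; apply/fsubsetP => b bB.
    apply/negPn/negP => bT; apply: (face_not_minimal (fB b bB) pT').
    apply/fsubsetP => w wT; rewrite inE; have [//|wV] := boolP (w \in V).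
    have wTV : w \in T' `\` V by rewrite inE wV.
    have wB := fsubsetP T'B _ wTV.
    by rewrite 2!inE wB andbT; apply: contraNneq bT => <-.
  have eQ : Q `\` V = B.
    apply: tr => //; apply/fsubsetP => u; rewrite inE => /andP[uV /(fsubsetP QVB)].
    by rewrite inE (negPf uV).
  exists Q; rewrite eQ; split=> //.
    split; last by move=> A [Q' [pQ' _ ->]]; exact: tr.
    exists Q; split=> // QV0; apply: (face_not_minimal fBB pQ).
    rewrite -eQ; apply/fsubsetP => u uQ; rewrite inE uQ andbT; apply/negP => uV.
    by have : u \in Q `&` V; [rewrite inE uQ | rewrite QV0 inE].
  move=> S SU [T' [pT' T'S]].
  have /fsubsetPn[u uU uS] : ~~ (U `<=` S) by move: SU; rewrite fproperE => /andP[].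
  apply: (face_not_minimal (fBU u uU) pT'); apply: (fsubset_trans T'S).
  apply: fsetUS; apply/fsubsetP => w wS; rewrite !inE.
  rewrite (fsubsetP (fproper_sub SU)) // andbT; apply: contraNneq uS => <-; exact: wS.
case=> [->|[pP nVP PU]|[Q [pQ Bmin nST ->]]].
- split=> //; first by move=> /(face'P vertexV)[].
  move=> v vV; apply/face'P; first exact: vD1.
  split; first by move=> /fsubsetP/(_ v vV); rewrite !inE eqxx.
  by left; apply: face_sub faceV; exact: fsubD1set.
- have [P0 vP nfP Pf] := pP; split=> //.
    move=> /(face'P vP)[_ [//|[UP _]]]; apply: PU.
    by rewrite (minimal_nonface_eq pP primU UP).
  move=> u uP; apply/face'P; first exact: vD1.
  split; last by left; exact: Pf.
  by move=> /fsubset_trans/(_ (fsubD1set _ _)).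
have [vB BV BU nVB fB] := minimal_trace_link Bmin.
set B := Q `\` V in vB BV BU nVB fB nST *.
have vBU u : u \in B `|` U -> vertex u by rewrite inE => /orP[/vB|/vertexU].
have nVBU u : u \in B `|` U -> u \in V -> False.
  by rewrite inE => /orP[/BV|/UV0].
split=> //.
- have /fset0Pn[u uU] : U != fset0 by case: primU.
  by apply/fset0Pn; exists u; rewrite inE uU orbT.
- move=> /(face'P vBU)[_ [fBU|[_]]].
    by apply: nfU; apply: face_sub fBU; exact: fsubsetUr.
  rewrite (_ : (B `|` U) `\` U = B) //; apply/fsetP => u; rewrite !inE.
  have [uU|uU] /= := boolP (u \in U); last by rewrite orbF.
  apply/esym/negP => uB; apply: (BU u) => //.
  by rewrite !inE.
move=> u uBU; apply/face'P; first exact: vD1.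
split.
  apply: disjoint_not_supset => w; rewrite 2!inE => /andP[_]; exact: nVBU.
have [uU|uU] := boolP (u \in U).
  left; apply: contrapT => nf; have [|T pT TB] := nonface_minimal _ nf.
    exact: vD1.
  apply: (nST (U `\ u)); first exact: fproperD1.
  exists T; split=> //; apply: (fsubset_trans TB); apply/fsubsetP => w.
  by rewrite !inE => /andP[-> /orP[->//|->]]; rewrite orbT.
have uB : u \in B by move: uBU; rewrite inE (negPf uU) orbF.
right; split.
  apply/fsubsetP => w wU; rewrite 2!inE; apply/andP; split.
    by apply: contraNneq uU => <-.
  by rewrite inE wU orbT.
apply: face_sub (fB u uB); apply: fsetUS; apply/fsubsetP => w.
by rewrite !inE => /andP[wU /andP[-> /orP[->//|]]]; rewrite (negPf wU).
Qed.

End FlippedComplex.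
Lemma seq_argmin (R : realFieldType) (T : eqType) (s : seq T) (c : T -> R) x :
  x \in s -> exists2 y, y \in s & forall z, z \in s -> c y <= c z.
Proof.
elim: s x => // a s IH x _; have [->|s0] := eqVneq s [::].
  by exists a; rewrite ?inE // => z; rewrite inE => /eqP ->.
have [b bs] : exists b, b \in s by case: (s) s0 => // b l _; exists b; rewrite inE eqxx.
have [y ys ymin] := IH b bs; have [ay|ya] := leP (c a) (c y).
  exists a; first by rewrite inE eqxx.
  by move=> z /predU1P[->//|/ymin]; exact: le_trans.
exists y; first by rewrite inE ys orbT.
by move=> z /predU1P[->|/ymin //]; exact: ltW.
Qed.

Lemma sum_fset_indicator (R : realFieldType) (M : lmodType R) (K : choiceType)
    (A S : {fset K}) (g : K -> M) : S `<=` A ->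
  \sum_(f <- A) (f \in S)%:R *: g f = \sum_(f <- S) g f.
Proof.
move=> SA; rewrite [RHS](_ : _ = \sum_(f <- S) (f \in S)%:R *: g f).
  by apply/esym/big_fset_incl => // f _ /negPf ->; rewrite scale0r.
by rewrite big_seq [RHS]big_seq; apply: eq_bigr => f ->; rewrite scale1r.
Qed.

(** * The extremal contraction and the anti-flip *)

Section Flip.
Variables (R : realFieldType) (d : nat) (Sigma Sbar : fan R d).
Variables U V : {fset lattice d}.
Let r : lattice d -> R := relation_class R U V (fun=> 1%N).
Implicit Types (E F P : {fset lattice d}) (D : lattice d -> lattice d).
Implicit Types (sigma tau : set 'rV[R]_d) (f g u v : lattice d).

Hypothesis Ssmooth : smooth Sigma.
Hypothesis Scomplete : complete Sigma.
Hypothesis UVrel : primitive_relation Sigma U V (fun=> 1%N).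
Hypothesis ltUV : (#|` U| < #|` V|)%N.

Let cover := basic_cone_cover Ssmooth Scomplete.

Let primU : primitive_collection Sigma U.
Proof. by case: UVrel. Qed.

Lemma relation_sum : \sum_(u <- U) u = \sum_(v <- V) v.
Proof.
have [_ [sigma [_ _ _ _ ->]]] := UVrel.
by apply: eq_bigr => v _; rewrite mulr1n.
Qed.

Lemma relation_sumR : \sum_(u <- U) toNR R u = \sum_(v <- V) toNR R v.
Proof. by rewrite -!toNR_sum relation_sum. Qed.

Lemma relation_cone : exists2 F, basic_cone Sigma F & V `<=` F.
Proof.
have [_ [sigma [ss _ eV _ _]]] := UVrel.
have [F [S [bF SF e]]] := cover_face_of_basic (fun F bF => bF) cover ss.
exists F => //; suff -> : V = S by [].
apply/fsetP => u; have := ray_gens_basic bF SF; rewrite -e eV => /seteqP[VS SV].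
by apply/idP/idP => [/VS|/SV].
Qed.

Lemma relation_vertex v : v \in V -> G Sigma v.
Proof.
by have [F bF VF] := relation_cone => /(fsubsetP VF)/(basic_cone_G bF).
Qed.

Lemma basic_not_supset F : basic_cone Sigma F -> ~ (U `<=` F).
Proof.
by move=> bF UF; have [_ _ + _] := primU; apply; exact: basic_cone_face bF UF.
Qed.

(** If u lay on both sides, U \ u and V \ u would span cones of the fan with
    equal sums of generators, so they would coincide, and U and V would have
    the same cardinality. *)
Lemma relation_disjoint u : u \in U -> u \in V -> False.
Proof.
move=> uU uV; have [_ GU _ /(_ u uU) gU] := primU.
have [F bF VF] := relation_cone; have [[D FD] _] := bF.
have e : \sum_(w <- U `\ u) w = \sum_(w <- V `\ u) w.
  by have := relation_sum; rewrite (big_fsetD1 u uU) (big_fsetD1 u uV) /= => /addrI.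
have VuF : V `\ u `<=` F by apply: fsubset_trans VF; exact: fsubD1set.
have UuF : U `\ u `<=` F.
  apply: (basic_cone_sub bF gU); first by move=> w; rewrite !inE => /andP[_ /GU].
  rewrite -toNR_sum e toNR_sum big_seq; apply: cone_sum => w wV.
  by apply: cone_gen; exact: (fsubsetP VuF).
have eUV : U `\ u = V `\ u.
  apply/fsetP => f; have [fF|fF] := boolP (f \in F).
    have := coord_sum_gens R FD UuF fF; rewrite e (coord_sum_gens R FD VuF fF).
    by move=> /eqP; rewrite eqr_nat; do 2!case: (f \in _).
  by rewrite (contraNF (fsubsetP UuF f) fF) (contraNF (fsubsetP VuF f) fF).
by move: ltUV; rewrite (cardfsD1 u U) (cardfsD1 u V) uU uV eUV ltnn.
Qed.

Hypothesis contr : contraction Sigma r Sbar.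
Hypothesis GSbar : G Sigma = G Sbar.

(** The coefficients of the relation are 0, 1 and - 1, so a class on its ray that
    has a coefficient 1 is a positive multiple of it. *)
Lemma class_on_ray (b : lattice d -> int) f : on_ray r (fun u => (b u)%:~R) ->
  b f = 1 -> f \in U /\ forall u, u \in U \/ u \in V -> b u != 0.
Proof.
move=> [c c0 e] bf; have bE u : (b u)%:~R = c * r u.
  by rewrite -[RHS]/((fun u => c * r u) u) -e.
have rU u : u \in U -> r u = 1.
  move=> uU; rewrite /r /relation_class uU mul1r.
  by case: (boolP (u \in V)) => [/(relation_disjoint uU) //|_]; rewrite subr0.
have rV u : u \in V -> r u = -1.
  move=> uV; rewrite /r /relation_class uV mul1r.
  by case: (boolP (u \in U)) => [/relation_disjoint/(_ uV) //|_]; rewrite sub0r.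
have cn : c != 0.
  by apply/eqP => c1; have /eqP := bE f; rewrite bf c1 mul0r oner_eq0.
split=> [|u [/rU ru|/rV ru]].
- apply/negPn/negP => fU; have := bE f; rewrite bf /r /relation_class (negPf fU).
  rewrite mul1r sub0r mulrN => /eqP; rewrite -subr_eq0 opprK => /eqP h.
  suff : 1 <= 0 :> R by rewrite ler10.
  by rewrite -h lerDl mulr_ge0.
- by have := bE u; rewrite ru mulr1 => h; rewrite -(intr_eq0 R) h.
- by have := bE u; rewrite ru mulrN1 => h; rewrite -(intr_eq0 R) h oppr_eq0.
Qed.

Let bar_conv sigma s : Sbar sigma ->
  (forall u, u \in s -> sigma (toNR R u)) -> (cone R s `<=` sigma)%classic.
Proof.
by move=> /fan_polyhedral[t ->]; exact: cone_sub.
Qed.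

(** A functional that is nonnegative on sigma and vanishes on the facet of F
    opposite to f is a multiple of the coordinate at f, which takes both signs
    on sigma; so it is 0.  Hence no proper face of sigma contains the facet. *)
Lemma crossed_facet_contracted F D sigma f x :
  dual_basis F D -> Sbar sigma -> (cone R F `<=` sigma)%classic ->
  sigma x -> f \in F -> coord D f x < 0 -> contracted Sbar (cone R (F `\ f)).
Proof.
move=> FD ss Fs sx fF fx tau st Wt.
have Fg g : g \in F -> sigma (toNR R g) by move=> gF; apply: Fs; exact: cone_gen.
have ms := spanning_cone_maximal FD ss Fg; have [_ maxs] := ms.
have [[h hs e] _] := fan_inter ss st.
have hW g : g \in F -> g != f -> pairing h (toNR R g) = 0.
  move=> gF gf; have : (sigma `&` tau)%classic (toNR R g).
    by split; [exact: Fg | apply: Wt; apply: cone_gen; rewrite !inE gf].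
  by rewrite e => -[].
have hf : pairing h (toNR R f) = 0.
  apply/eqP; rewrite eq_le (hs _ (Fg f fF)) andbT.
  have := hs x sx; rewrite {1}(coord_span FD x) pairing_sumr.
  rewrite (bigD1_seq f fF (fset_uniq _)) /=.
  rewrite big_seq_cond big1 ?addr0 => [|g /andP[gF gf]].
    by rewrite pairingZr nmulr_rge0.
  by rewrite pairingZr hW // mulr0.
suff st' : (sigma `<=` tau)%classic.
  by rewrite (maxs tau st st').
move=> y sy; suff [] : (sigma `&` tau)%classic y by [].
rewrite e; split=> //; apply: (pairing_eq0 FD) => g gF.
by have [->//|gf] := eqVneq g f; exact: hW.
Qed.

(** The wall carries a contracted curve, whose class is that of the relation:
    its wall relation is sum U = sum V. *)
Lemma crossed_facet F D sigma f x :
  basic_cone Sigma F -> dual_basis F D ->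
  Sbar sigma -> (cone R F `<=` sigma)%classic ->
  sigma x -> f \in F -> coord D f x < 0 ->
  [/\ f \in U, V `<=` F & exists u, [/\ u \in U, u \notin F, U `<=` u |` F &
    basic_cone Sigma (u |` (F `\ f))]].
Proof.
move=> bF FD ss Fs sx fF fx; have cW := crossed_facet_contracted FD ss Fs sx fF fx.
have [u [b [uF bF' cb [bf bu] b0]]] := wall_crossing Ssmooth Scomplete bF fF.
have [_ _ /(_ _ _ cb)[/(_ cW) rb _]] := contr.
have [fU bn0] := class_on_ray rb bf; have [uU _] := class_on_ray rb bu.
have sup w : w \in U \/ w \in V -> w \in u |` F.
  by move=> /bn0; apply: contraNT => /b0 ->.
split=> //; last by exists u; split=> //; apply/fsubsetP => w wU; apply: sup; left.
apply/fsubsetP => v vV; have := sup v (or_intror vV); rewrite !inE => /predU1P[vu|//].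
by case: (relation_disjoint uU); rewrite -vu.
Qed.

Hypothesis UVext : extremal Sigma r.

(** The class of the relation is a nonnegative combination of classes of
    invariant curves, and by extremality every term lies on the ray. *)
Lemma contracted_curve : exists W b, curve_class Sigma W b /\
  on_ray r (fun u => (b u)%:~R).
Proof.
have [[n [W [b [c [Wb c0 er]]]]] [u ru] ext] := UVext.
have [i ci] : exists i, c i * (b i u)%:~R != 0.
  apply: contrapT => H; case/eqP: ru; rewrite er big1 // => i _.
  by apply/eqP/negPn/negP => ci; apply: H; exists i.
exists (W i), (b i); split=> //.
pose x u := c i * (b i u)%:~R; pose y u := \sum_(j < n | j != i) c j * (b j u)%:~R.
have NEx : NE Sigma x.
  exists 1%N, (fun=> W i), (fun=> b i), (fun=> c i); split=> //.
  by apply/funext => w; rewrite big_ord1.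
have NEy : NE Sigma y.
  exists n, W, b, (fun j => if j == i then 0 else c j); split=> // [j|].
    by case: ifP.
  apply/funext => w; rewrite (bigD1 i) //= eqxx mul0r add0r.
  by apply: eq_bigr => j /negPf ->.
have [|[a a0 xr] _] := ext x y NEx NEy.
  exists 1 => //; apply/funext => w.
  by rewrite mul1r [RHS](congr1 (fun h => h w) er) (bigD1 i).
have cn : c i != 0 by apply: contraNneq ci => ->; rewrite mul0r.
exists ((c i)^-1 * a); first by rewrite mulr_ge0 // invr_ge0.
apply/funext => w; rewrite -mulrA -[a * r w](congr1 (fun h => h w) xr) /x.
by rewrite mulrA mulVf // mul1r.
Qed.

(** The two cones adjacent to the wall of a contracted curve lie in the same
    cone of the base: the cones above them intersect in a cone that contains
    the wall, and such a cone is maximal. *)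
Lemma relation_in_bar : exists2 sigma, maximal_cone Sbar sigma &
  forall u, u \in U \/ u \in V -> sigma (toNR R u).
Proof.
have [W [b [cb rb]]] := contracted_curve.
have [_ [ref _] /(_ _ _ cb)[_ /(_ rb) cW]] := contr.
have [f [f' [[_ _ _ _] _ [gf gf'] [bf bf' b0] _]]] := cb.
have [s ss fs] := ref _ gf; have [s' ss' fs'] := ref _ gf'.
have Ws (t : set 'rV[R]_d) f0 :
    (cone R (f0 |` W)%fset `<=` t)%classic -> (cone R W `<=` t)%classic.
  move=> tW; apply: (subset_trans _ tW).
  by apply: subset_cone => w wW; rewrite !inE wW orbT.
have ms := cW s ss (Ws _ _ fs); have ms' := cW s' ss' (Ws _ _ fs').
have si : Sbar (s `&` s')%classic.
  by apply: (fan_face ss); case: (fan_inter ss ss').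
have [_ mi] : maximal_cone Sbar (s `&` s')%classic.
  by apply: cW => // x xW; split; [exact: Ws fs _ xW | exact: Ws fs' _ xW].
have es : s = s'.
  exact: etrans (mi s ss (fun _ => @proj1 _ _)) (esym (mi s' ss' (fun _ => @proj2 _ _))).
exists s => // u uUV; have [_ /(_ u uUV) bu] := class_on_ray rb bf.
have : u \in f |` (f' |` W) by apply: contraNT bu => /b0 ->.
rewrite !inE => /orP[uf|/orP[uf'|uW]].
- by apply: fs; apply: cone_gen; rewrite !inE uf.
- by rewrite es; apply: fs'; apply: cone_gen; rewrite !inE uf'.
- by apply: fs; apply: cone_gen; rewrite !inE uW orbT.
Qed.

(** The pull-back of an ample divisor has degree 0 on the contracted class.  Its
    local equation at sigma takes its minimal values on V, hence also on U, and
    these are attained only inside sigma. *)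
Lemma bar_cone_closed sigma : maximal_cone Sbar sigma ->
  (forall v, v \in V -> sigma (toNR R v)) -> forall u, u \in U -> sigma (toNR R u).
Proof.
move=> ms Vs; have [[_ [a aa]] _ _] := contr; have [ss _] := ms.
have [s0 ms0 UVs0] := relation_in_bar.
have [m0 [m0s _]] := aa s0 ms0 (fun _ _ => I).
have GU u : u \in U -> G Sigma u by case: primU => _ + _ _; exact.
have deg : \sum_(u <- U) (a u)%:~R = \sum_(v <- V) (a v)%:~R :> R.
  apply: oppr_inj; rewrite -!sumrN.
  have := congr1 (pairing m0) relation_sumR; rewrite !pairing_sumr => e.
  rewrite big_seq [RHS]big_seq; rewrite big_seq [RHS]big_seq in e.
  have m0E u : u \in U \/ u \in V -> pairing m0 (toNR R u) = - (a u)%:~R.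
    move=> uUV; apply/m0s/(ray_gensP _ ms0.1); split; last exact: UVs0.
    rewrite -GSbar; case: uUV => [/GU //|]; exact: relation_vertex.
  rewrite -(eq_bigr _ (fun u uU => m0E u (or_introl uU))) e.
  by apply: eq_bigr => v vV; rewrite m0E //; right.
have [m [ms1 ms2]] := aa sigma ms (fun _ _ => I).
have mV : \sum_(v <- V) pairing m (toNR R v) = - \sum_(v <- V) (a v)%:~R.
  rewrite -sumrN big_seq [RHS]big_seq; apply: eq_bigr => v vV.
  apply/ms1/(ray_gensP _ ss); split; last exact: Vs.
  by rewrite -GSbar; exact: relation_vertex.
have mU u : u \in U -> 0 <= pairing m (toNR R u) + (a u)%:~R.
  move=> uU; have Gu : G Sbar u by rewrite -GSbar; exact: GU.
  have [su|nsu] := pselect (sigma (toNR R u)).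
    by rewrite ms1 ?addNr //; apply/(ray_gensP _ ss).
  by rewrite -[(a u)%:~R]opprK subr_ge0 ltW // ms2.
have /eqP : \sum_(u <- U) (pairing m (toNR R u) + (a u)%:~R) = 0.
  by rewrite big_split /= -pairing_sumr relation_sumR pairing_sumr mV deg addNr.
rewrite big_seq psumr_eq0 // => /allP u0 u uU; apply: contrapT => nsu.
have Gu : G Sbar u by rewrite -GSbar; exact: GU.
have /implyP/(_ uU) := u0 u uU.
by rewrite -[(a u)%:~R]opprK subr_eq0 gt_eqF // ms2.
Qed.

Let bar_above F : basic_cone Sigma F ->
  exists2 sigma, maximal_cone Sbar sigma & (cone R F `<=` sigma)%classic.
Proof.
move=> [[D FD] sF]; have [_ [ref _] _] := contr.
have [s ss Fs] := ref _ sF; exists s => //.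
by apply: (spanning_cone_maximal FD ss) => f fF; apply: Fs; exact: cone_gen.
Qed.

Let cone_all F sigma : (cone R F `<=` sigma)%classic ->
  forall f, f \in F -> sigma (toNR R f).
Proof. by move=> Fs f fF; apply: Fs; exact: cone_gen. Qed.

(** A vertex u of U off F lies in the cone of the base above F, so some facet of
    F is crossed and crossed_facet applies: u is the only vertex of U off F.
    By u = sum V - sum (U \ u) the coordinate of u at every other vertex of U
    is - 1, so that the corresponding facets are crossed as well. *)
Lemma star_structure F : basic_cone Sigma F -> V `<=` F ->
  exists u, [/\ u \in U, u \notin F, U `<=` u |` F &
    forall y, y \in U -> y != u -> basic_cone Sigma (u |` (F `\ y))].
Proof.
move=> bF VF; have [[D FD] _] := bF.
have [s ms Fs] := bar_above bF; have [ss _] := ms.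
have Us : forall u, u \in U -> s (toNR R u).
  by apply: bar_cone_closed => // v /(fsubsetP VF)/(cone_all Fs).
have GU u : u \in U -> G Sigma u by case: primU => _ + _ _; exact.
have /negP/fsubsetPn[u uU uF] := basic_not_supset bF.
have [|y yF yu] := @notin_basis_cone R d F D FD (toNR R u).
  move=> Fu; case/negP: uF.
  exact: (basic_cone_gens bF (fsubset_refl _) (GU _ uU) Fu).
have [_ _ [u' [u'U u'F Uu' _]]] := crossed_facet bF FD ss Fs (Us _ uU) yF yu.
have uu' : u = u'.
  by have := fsubsetP Uu' _ uU; rewrite !inE (negPf uF) orbF => /eqP.
subst u'; exists u; split=> // z zU zu.
have zF : z \in F by have := fsubsetP Uu' _ zU; rewrite !inE (negPf zu).
have UuF : U `\ u `<=` F.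
  apply/fsubsetP => w; rewrite !inE => /andP[wu /(fsubsetP Uu')].
  by rewrite !inE (negPf wu).
have cz : coord D z (toNR R u) = -1.
  have := congr1 (coord D z) (congr1 (toNR R) relation_sum).
  rewrite (big_fsetD1 u uU) /= toNRD coordD (coord_sum_gens R FD UuF zF).
  rewrite (coord_sum_gens R FD VF zF) !inE zu zU /=.
  case: (boolP (z \in V)) => [/(relation_disjoint zU) //|_].
  by move=> /eqP; rewrite addr_eq0 => /eqP.
have [|_ _ [w [wU wF _ bF']]] := crossed_facet bF FD ss Fs (Us _ uU) zF.
  by rewrite cz oppr_lt0 ltr01.
suff <- : w = u by [].
by have := fsubsetP Uu' _ wU; rewrite !inE (negPf wF) orbF => /eqP.
Qed.

(** M times the relation sum U = sum V is added to the expansion of x in F, with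
    M such that z disappears. *)
Lemma coord_shift F D u z x (M : R) : dual_basis F D ->
  V `<=` F -> U `<=` u |` F -> u \notin F -> z \in F ->
  let e f := (f \in F)%:R * coord D f x + M * ((f \in U)%:R - (f \in V)%:R) in
  e z = 0 -> x = \sum_(f <- u |` (F `\ z)) e f *: toNR R f.
Proof.
move=> FD VF UF uF zF e ez.
have uz : u != z by apply: contraNneq uF => ->.
have eA : u |` (F `\ z) = (u |` F) `\ z.
  apply/fsetP => f; rewrite !inE; case: (eqVneq f z) => [->|] //=.
  by rewrite orbF eq_sym (negPf uz).
have -> : \sum_(f <- u |` (F `\ z)) e f *: toNR R f =
    \sum_(f <- u |` F) e f *: toNR R f.
  rewrite eA [RHS](big_fsetD1 z) /=; last by rewrite !inE zF orbT.
  by rewrite ez scale0r add0r.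
have -> : \sum_(f <- u |` F) e f *: toNR R f =
    \sum_(f <- u |` F) (f \in F)%:R *: (coord D f x *: toNR R f) +
    M *: (\sum_(f <- u |` F) (f \in U)%:R *: toNR R f -
          \sum_(f <- u |` F) (f \in V)%:R *: toNR R f).
  rewrite -sumrB scaler_sumr -big_split; apply: eq_bigr => f _.
  by rewrite /e /= scalerDl -scalerBl !scalerA.
rewrite !sum_fset_indicator //; last 2 first.
- exact: fsubset_trans VF (fsubsetU1 _ _).
- exact: fsubsetU1.
by rewrite relation_sumR subrr scaler0 addr0 -(coord_span FD).
Qed.

(** If g is off F, its negative coordinates are at vertices of U, by
    crossed_facet.  Adding a multiple of the relation makes the smallest of
    them 0, which passes to the neighbouring cone F' with no negative
    coordinate at U; then crossed_facet for F' excludes negative coordinates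
    altogether. *)
Lemma bar_cone_gens F sigma g : basic_cone Sigma F -> maximal_cone Sbar sigma ->
  (cone R F `<=` sigma)%classic -> G Sigma g -> sigma (toNR R g) ->
  g \in F \/ V `<=` F /\ g \in U.
Proof.
move=> bF ms Fs Gg sg; have [[D FD] _] := bF; have [ss _] := ms.
have [gF|gF] := boolP (g \in F); [by left | right].
have [|y0 y0F y0g] := @notin_basis_cone R d F D FD (toNR R g).
  by move=> Fg; case/negP: gF; exact: basic_cone_gens bF (fsubset_refl _) Gg Fg.
have [y0U VF _] := crossed_facet bF FD ss Fs sg y0F y0g.
have [u [uU uF UF bas]] := star_structure bF VF.
have Us : forall w, w \in U -> sigma (toNR R w).
  by apply: bar_cone_closed => // v /(fsubsetP VF)/(cone_all Fs).
have y0UF : y0 \in U `&` F by rewrite inE y0U.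
have [y + ymin] := seq_argmin (fun f => coord D f (toNR R g)) y0UF.
rewrite inE => /andP[yU yF].
have yu : y != u by apply: contraNneq uF => <-.
set M := - coord D y (toNR R g).
have M0 : 0 <= M by rewrite oppr_ge0 (le_trans (ymin _ y0UF)) // ltW.
have UV0 w : w \in U -> (w \in V) = false.
  by move=> wU; apply/negP => /(relation_disjoint wU).
have bF' := bas y yU yu; set F' := u |` (F `\ y) in bF'.
have [[D' FD'] _] := bF'.
have := @coord_shift F D u y (toNR R g) M FD VF UF uF yF.
rewrite /= yF yU UV0 // subr0 mulr1 mul1r subrr => /(_ erefl) eg.
have F's : (cone R F' `<=` sigma)%classic.
  apply: bar_conv => // f; rewrite !inE => /predU1P[->|/andP[_ fF]].
    exact: Us.
  exact: cone_all Fs _ fF.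
have F'g : cone R F' (toNR R g).
  apply/(basis_coneP FD') => k kF'; rewrite leNgt; apply/negP => kg.
  have [kU _ _] := crossed_facet bF' FD' ss F's sg kF' kg.
  move: kg; rewrite {1}eg (coord_comb FD') ?fsubset_refl // kF' mul1r.
  rewrite kU UV0 // subr0 mulr1 ltNge.
  have [kF|kF] /= := boolP (k \in F); last by rewrite mul0r add0r M0.
  by rewrite mul1r /M subr_ge0 ymin // inE kU.
have := basic_cone_gens bF' (fsubset_refl _) Gg F'g.
by rewrite !inE (negPf gF) andbF orbF => /eqP ->.
Qed.

(** The maximal cones of the new fan: those of Sigma that do not contain V, and,
    by star_structure, the joins of U, a facet of V and a maximal face of the
    link of V. *)
Definition flipped_cone E : Prop :=
  (basic_cone Sigma E /\ ~ (V `<=` E)) \/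
  exists F u v, [/\ basic_cone Sigma F, V `<=` F,
    [/\ u \in U, u \notin F & U `<=` u |` F], v \in V & E = u |` (F `\ v)].

Lemma flipped_dual_basis E : flipped_cone E -> exists D, dual_basis E D.
Proof.
case=> [[[]] //|[F [u [v [bF VF [uU uF UF] vV ->]]]]].
have [[D FD] _] := bF; have vF := fsubsetP VF _ vV.
apply: (dual_basis_swap FD vF uF).
have UuF : U `\ u `<=` F.
  apply/fsubsetP => w; rewrite !inE => /andP[wu /(fsubsetP UF)].
  by rewrite !inE (negPf wu).
have := congr1 (dotz (D v)) relation_sum; rewrite (big_fsetD1 u uU) /= dotzDr.
rewrite (dotz_sum_gens R FD UuF vF) (dotz_sum_gens R FD VF vF) vV !inE.
case: (boolP (v \in U)) => [/relation_disjoint/(_ vV) //|_].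
by rewrite andbF addr0.
Qed.

(** In a cone that contains V, the multiple of the relation is subtracted that
    makes the smallest coordinate at V vanish. *)
Lemma flipped_cover x : exists2 E, flipped_cone E & cone R E x.
Proof.
have [F bF Fx] := cover x.
have [VF|VF] := pselect (V `<=` F); last by exists F => //; left.
have [u [uU uF UF _]] := star_structure bF VF; have [[D FD] _] := bF.
have [w wV] : exists w, w \in V.
  by apply/fset0Pn; rewrite -cardfs_gt0 (leq_ltn_trans _ ltUV).
have [v vV vmin] := seq_argmin (fun f => coord D f x) wV.
exists (u |` (F `\ v)); first by right; exists F, u, v.
have vF := fsubsetP VF _ vV; have x0 := (basis_coneP FD x).1 Fx.
have UV0 z : z \in V -> (z \in U) = false.
  by move=> zV; apply/negP => /relation_disjoint/(_ zV).
have := @coord_shift F D u v x (coord D v x) FD VF UF uF vF.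
rewrite /= vF vV UV0 // sub0r mulrN1 mul1r subrr => /(_ erefl) ->.
rewrite big_seq; apply: cone_sum => f fE; apply: coneZ; last exact: cone_gen.
have [fV|fV] := boolP (f \in V).
  by rewrite (fsubsetP VF _ fV) UV0 // sub0r mulrN1 mul1r subr_ge0 vmin.
rewrite subr0 addr_ge0 //; last by rewrite mulr_ge0 // x0.
by case: (boolP (f \in F)) => [/x0|_]; rewrite ?mul1r ?mul0r.
Qed.

(** At the omitted vertex v = sum U - sum (V \ v), the functional that is 1 on E
    takes the value |U| - (|V| - 1), which is at most 0 because |U| < |V|. *)
Lemma flipped_support E D : flipped_cone E -> dual_basis E D ->
  exists2 sigma, maximal_cone Sbar sigma &
    (forall e, e \in E -> sigma (toNR R e)) /\
    forall g, G Sigma g -> sigma (toNR R g) -> g \notin E ->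
      pairing (\sum_(e <- E) toNR R (D e)) (toNR R g) < 1.
Proof.
move=> fE ED; case: fE => [[bE nVE]|[F [u [v [bF VF [uU uF UF] vV eE]]]]].
  have [s ms Es] := bar_above bE; exists s => //; split; first exact: cone_all.
  move=> g Gg sg gE; case: (bar_cone_gens bE ms Es Gg sg) => [|[]//].
  by rewrite (negPf gE).
have [s ms Fs] := bar_above bF; exists s => //.
have Us : forall w, w \in U -> s (toNR R w).
  by apply: bar_cone_closed => // w /(fsubsetP VF)/(cone_all Fs).
have vU : v \notin U by apply/negP => /relation_disjoint/(_ vV).
split=> [e|g Gg sg gE].
  rewrite eE !inE => /predU1P[->|/andP[_ eF]]; first exact: Us.
  exact: cone_all Fs _ eF.
have gv : g = v.
  move: gE; rewrite eE !inE negb_or negb_and negbK => /andP[gu gvF].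
  case: (bar_cone_gens bF ms Fs Gg sg) => [gF|[_ /(fsubsetP UF)]].
    by move: gvF; rewrite gF orbF => /eqP.
  by rewrite !inE (negPf gu) /= => gF; move: gvF; rewrite gF orbF => /eqP.
rewrite gv; have UE : U `<=` E.
  rewrite eE; apply/fsubsetP => w wU; have := fsubsetP UF _ wU; rewrite !inE.
  by case: (eqVneq w v) => // wv; rewrite -wv wU in vU.
have VE : V `\ v `<=` E.
  rewrite eE; apply/fsubsetP => w; rewrite !inE => /andP[-> /(fsubsetP VF) ->].
  by rewrite orbT.
have card S : S `<=` E -> \sum_(e <- E) (e \in S)%:R = #|` S|%:R :> R.
  move=> SE; rewrite -sum1_size natr_sum -(@sum_fset_indicator R R^o _ _ _ _ SE).
  by apply: eq_bigr => e _; rewrite -[RHS]/((e \in S)%:R * 1) mulr1.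
have -> : pairing (\sum_(e <- E) toNR R (D e)) (toNR R v) =
    \sum_(e <- E) (e \in U)%:R - \sum_(e <- E) (e \in V `\ v)%:R.
  rewrite pairing_suml -sumrB big_seq [RHS]big_seq; apply: eq_bigr => e eE'.
  rewrite -[LHS]/(coord D e (toNR R v)).
  have := congr1 (coord D e) (congr1 (toNR R) relation_sum).
  rewrite (big_fsetD1 v vV) /= toNRD coordD (coord_sum_gens R ED UE eE').
  by rewrite (coord_sum_gens R ED VE eE') => ->; rewrite addrK.
rewrite !card // ltrBlDr addrC natr1 ltr_nat.
by move: ltUV; rewrite (cardfsD1 v V) vV add1n.
Qed.

Variable Splus : fan R d.
Hypothesis Splus_refines : refines Splus Sbar.
Hypothesis GSplus : G Splus = G Sbar.
Hypothesis Splus_ample : relatively_ample Splus Sbar (@anticanonical d).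

Lemma Splus_complete : complete Splus.
Proof.
have [[Sb _] _ _] := contr; have [_ e] := Splus_refines.
by rewrite /complete e.
Qed.

(** Let hE be the functional that is 1 on E, and let m be the local equation of
    the anticanonical divisor on a maximal cone s' of Splus that contains the
    sum x of E.  The inequality hE <= 1 = - m on the generators of s' gives
    hE x <= - m x, and - m <= 1 = hE on E gives the converse; so m = - hE, and
    by strict convexity s' and E have the same generators. *)
Lemma flipped_in_Splus E : flipped_cone E -> basic_cone Splus E.
Proof.
move=> fE; have [D ED] := flipped_dual_basis fE; split; first by exists D.
have [s ms [Es supp]] := flipped_support fE ED; have [ss _] := ms.
set x := \sum_(e <- E) toNR R e; set hE := \sum_(e <- E) toNR R (D e) in supp.
have hEe e : e \in E -> pairing hE (toNR R e) = 1.
  move=> eE; rewrite pairing_suml (bigD1_seq e eE (fset_uniq _)) /=.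
  rewrite big_seq_cond big1 ?addr0.
    by rewrite -[LHS]/(coord D e (toNR R e)) (coord_gen R ED) // eqxx.
  move=> f /andP[fE' fe]; rewrite -[LHS]/(coord D f (toNR R e)).
  by rewrite (coord_gen R ED) // (negPf fe).
have [s1 ss1 s1x] : Defs.support Splus x by rewrite Splus_complete.
have [s' ms' s1s'] := maximal_cone_above ss1; have [ss' _] := ms'.
have s'x : s' x by exact: s1s'.
have [t st s't] := Splus_refines.1 _ ss'.
have et : t = s.
  by apply: ms.2 => //; apply: (spanning_cone_sub ED ss st Es); exact: s't.
rewrite {}et in st s't.
have [m [m1 m2]] := Splus_ample ss ms' s't.
have ml g : G Splus g -> s (toNR R g) -> - 1 <= pairing m (toNR R g).
  move=> Gg sg; have [s'g|ns'g] := pselect (s' (toNR R g)).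
    by rewrite m1 //; apply/(ray_gensP _ ss').
  by apply: ltW; exact: m2.
have GE e : e \in E -> G Splus e.
  move=> eE; rewrite GSplus -GSbar.
  case: fE => [[bE _]|[F [u [v [bF VF [uU _ _] _ eE']]]]].
    exact: basic_cone_G bE eE.
  move: eE; rewrite eE' !inE => /predU1P[->|/andP[_]]; last exact: basic_cone_G.
  by case: primU => _ + _ _; exact.
have [p ep] := fan_polyhedral ss'.
have [|q qp epq] := @cone_ray_gens R d p.
  by rewrite -ep; exact: fan_strongly_convex ss'.
have qG g : g \in q -> ray_gens s' g by rewrite ep; exact: qp.
have qs' g : g \in q -> G Splus g /\ s (toNR R g).
  by move=> /qG/(ray_gensP _ ss')[Gg /s't].
have hEq g : g \in q -> pairing hE (toNR R g) <= 1.
  move=> /qs'[Gg sg]; have [gE|gE] := boolP (g \in E); first by rewrite hEe.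
  by apply/ltW/supp => //; rewrite GSbar -GSplus.
have mx : pairing m x <= - pairing hE x.
  move: s'x; rewrite ep epq => -[c c0 ->]; rewrite !pairing_sumr -sumrN.
  rewrite big_seq [X in _ <= X]big_seq; apply: ler_sum => g gq.
  rewrite !pairingZr m1; last exact: qG.
  by rewrite -mulrN ler_wpM2l // lerN2 hEq.
have mE e : e \in E -> pairing m (toNR R e) = -1.
  have : \sum_(e <- E) (pairing m (toNR R e) + 1) == 0.
    rewrite eq_le; apply/andP; split; last first.
      rewrite big_seq sumr_ge0 // => f fE'; rewrite -lerBlDr sub0r.
      by apply: ml; [exact: GE | exact: Es].
    rewrite big_split /= -pairing_sumr -lerBrDr sub0r (le_trans mx) // lerN2.
    by rewrite /x pairing_sumr big_seq [X in _ <= X]big_seq ler_sum // => f /hEe ->.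
  rewrite big_seq psumr_eq0 => [/allP e0 eE|f fE'].
    by have /implyP/(_ eE) := e0 e eE; rewrite addr_eq0 => /eqP.
  by rewrite -lerBlDr sub0r; apply: ml; [exact: GE | exact: Es].
have Es' e : e \in E -> s' (toNR R e).
  move=> eE; apply: contrapT => ns'e.
  have := m2 e (GE e eE) (Es e eE) ns'e.
  by rewrite mE // ltxx.
have mhE : m = - hE.
  by apply: (pairing_gens_inj ED) => e eE; rewrite pairingNl hEe // mE.
suff <- : s' = cone R E by [].
apply/seteqP; split; last by move: Es'; rewrite ep; exact: cone_sub.
rewrite ep epq; apply: subset_cone => g gq; apply/negPn/negP => gE.
have [Gg sg] := qs' g gq.
have : pairing hE (toNR R g) < 1 by apply: supp => //; rewrite GSbar -GSplus.
have := m1 g (qG g gq); rewrite mhE pairingNl => /oppr_inj ->.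
by rewrite ltxx.
Qed.

(** Unlike generates, this is stable under passing to arbitrary subsets. *)
Definition spanned P : Prop := exists2 F, basic_cone Sigma F & P `<=` F.

Lemma spanned_sub A B : A `<=` B -> spanned B -> spanned A.
Proof. by move=> AB [F bF BF]; exists F => //; exact: fsubset_trans BF. Qed.

Lemma generates_spannedP P : (forall u, u \in P -> G Sigma u) ->
  generates Sigma P <-> spanned P.
Proof. exact: (cover_generatesP (fun F bF => bF) cover). Qed.

Lemma spanned_star B u : spanned (V `|` B) -> u \in U ->
  (forall w, w \in B -> w \in U -> False) -> spanned ((V `|` B) `|` (U `\ u)).
Proof.
move=> [F bF VBF] uU BU.
have VF : V `<=` F by apply: fsubset_trans VBF; exact: fsubsetUl.
have [w [wU wF UF bas]] := star_structure bF VF.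
have [uw|uw] := eqVneq u w.
  exists F => //; rewrite fsubUset VBF /=; apply/fsubsetP => z.
  rewrite !inE uw => /andP[zw /(fsubsetP UF)]; by rewrite !inE (negPf zw).
exists (w |` (F `\ u)); first exact: bas.
apply/fsubsetP => z; rewrite [in X in X -> _]inE => /orP[zVB|].
  rewrite !inE (fsubsetP VBF _ zVB) andbT; apply/orP; right.
  apply/eqP => zu; move: zVB; rewrite zu inE => /orP[/(relation_disjoint uU) //|uB].
  exact: BU uB uU.
by rewrite !inE => /andP[-> /(fsubsetP UF)]; rewrite !inE.
Qed.

Lemma generates_SplusP P : (forall u, u \in P -> G Sigma u) ->
  generates Splus P <->
  ~ (V `<=` P) /\ (spanned P \/ (U `<=` P /\ spanned (V `|` (P `\` U)))).
Proof.
move=> GP; rewrite (cover_generatesP flipped_in_Splus flipped_cover); last first.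
  by rewrite GSplus -GSbar.
split=> [[E fE PE]|[VP H]].
  case: fE => [[bE nVE]|[F [u [v [bF VF [uU uF UF] vV eE]]]]].
    by split=> [VP|]; [exact: nVE (fsubset_trans VP PE) | left; exists E].
  have vU : v \notin U by apply/negP => /relation_disjoint/(_ vV).
  have uv : v != u by apply: contraNneq vU => ->.
  split=> [VP|].
    have := fsubsetP (fsubset_trans VP PE) _ vV.
    by rewrite eE !inE eqxx (negPf uv).
  have PuF z : z \in P -> z != u -> z \in F.
    move=> /(fsubsetP PE); rewrite eE !inE.
    by move=> /predU1P[->|/andP[_ ->]]; rewrite ?eqxx.
  have [UP|UP] := pselect (U `<=` P).
    right; split=> //; exists F => //; rewrite fsubUset VF /=.
    apply/fsubsetP => z; rewrite inE => /andP[zU zP]; apply: PuF => //.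
    by apply: contraNneq zU => ->.
  left; have [z zU zP] : exists2 z, z \in U & z \notin P by apply: nsubsetP.
  have [zu|zu] := eqVneq z u.
    exists F => //; apply/fsubsetP => w wP; apply: PuF => //.
    by apply: contraNneq zP => wu; rewrite zu -wu.
  have [u' [u'U u'F UF' bas]] := star_structure bF VF.
  have uu' : u' = u.
    by have := fsubsetP UF' _ uU; rewrite !inE (negPf uF) orbF => /eqP.
  exists (u |` (F `\ z)); first by rewrite -uu'; apply: bas => //; rewrite uu'.
  apply/fsubsetP => w wP; rewrite !inE; case: (eqVneq w u) => //= wu.
  by rewrite PuF // andbT; apply: contraNneq zP => <-.
have [v vV vP] : exists2 v, v \in V & v \notin P by apply: nsubsetP.
have vU : v \notin U by apply/negP => /relation_disjoint/(_ vV).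
case: H => [[F bF PF]|[UP [F bF]]].
  have [VF|VF] := pselect (V `<=` F); last by exists F => //; left.
  have [u [uU uF UF _]] := star_structure bF VF.
  exists (u |` (F `\ v)); first by right; exists F, u, v.
  apply/fsubsetP => w wP; rewrite !inE (fsubsetP PF) // andbT.
  by apply/orP; right; apply: contraNneq vP => <-.
rewrite fsubUset => /andP[VF PF]; have [u [uU uF UF _]] := star_structure bF VF.
exists (u |` (F `\ v)); first by right; exists F, u, v.
apply/fsubsetP => w wP; rewrite !inE.
have wv : w != v by apply: contraNneq vP => <-.
rewrite wv /=; have [wU|wU] := boolP (w \in U).
  by have := fsubsetP UF _ wU; rewrite !inE.
by rewrite (fsubsetP PF) ?orbT // inE wU.
Qed.

End Flip.

(** * Projectivity and conclusion *)

Section Projectivity.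
Variable R : archiRealFieldType.

Lemma large_all (T : eqType) (s : seq T) (P : T -> nat -> Prop) :
  (forall i, i \in s -> exists N, forall n, (N <= n)%N -> P i n) ->
  exists N, forall n, (N <= n)%N -> forall i, i \in s -> P i n.
Proof.
elim: s => [|i s IH] sP; first by exists 0%N.
have [|N HN] := IH; first by move=> j js; apply: sP; rewrite inE js orbT.
have [|N' HN'] := sP i; first by rewrite inE eqxx.
exists (maxn N N') => n; rewrite geq_max => /andP[Nn N'n] j /predU1P[->|js].
  exact: HN'.
exact: HN.
Qed.

Lemma large_multiple_gt (a b : R) : 0 < a ->
  exists N, forall n, (N <= n)%N -> b < n%:R * a.
Proof.
move=> a0; exists (Num.bound (`|b| / a)) => n Nn.
apply: le_lt_trans (ler_norm b) _; rewrite -ltr_pdivrMr //.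
apply: lt_le_trans (archi_boundP _) _; first by rewrite divr_ge0 // ltW.
by rewrite ler_nat.
Qed.


Lemma finite_vertices d (Sigma : fan R d) :
  (forall x, exists2 F, basic_cone Sigma F & cone R F x) ->
  exists s : seq (lattice d), forall u, G Sigma u -> u \in s.
Proof.
move=> cover.
have [s sS] := fan_seq Sigma.
pose basis sigma : {fset lattice d} :=
  if pselect (exists F, basic_cone Sigma F /\ sigma = cone R F) is left P
  then projT1 (cid P) else fset0.
exists (flatten [seq enum_fset (basis sigma) | sigma <- s]) => u Gu.
have [F bF Fu] := cover (toNR R u).
apply/flatten_mapP; exists (cone R F).
  by apply/sS; exact: bF.2.
rewrite /basis; case: pselect => [P|]; last by case; exists F.
case: (cid P) => F' /= [bF' e]; apply: (basic_cone_gens bF') => //.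
by rewrite -e.
Qed.

(** A large multiple of the pull-back of an ample divisor a is added to b.  The
    convexity inequality of the pull-back at a cone sigma is strict off the cone
    of the base above sigma; on that cone it is an equality, and there the
    inequality of b is strict. *)
Lemma relatively_ample_projective d (Sigma Sbar : fan R d) (b : lattice d -> int) :
  (exists s : seq (lattice d), forall u, G Sigma u -> u \in s) ->
  projective Sbar -> refines Sigma Sbar -> G Sigma = G Sbar ->
  relatively_ample Sigma Sbar b -> projective Sigma.
Proof.
move=> [verts vertsP] [Sbar_complete [a ampa]] [ref esupp] eG ampb; split.
  by rewrite /complete esupp.
pose ab n u : int := n%:Z * a u + b u.
suff [N ampN] : exists N, forall n, (N <= n)%N -> ample Sigma (ab n).
  by exists (ab N); exact: ampN.
have [s sS] := fan_seq Sigma.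
pose good sigma n := maximal_cone Sigma sigma -> exists m : 'rV[R]_d,
    (forall u, ray_gens sigma u -> pairing m (toNR R u) = - (ab n u)%:~R) /\
    (forall u, G Sigma u -> setT (toNR R u) -> ~ sigma (toNR R u) ->
       - (ab n u)%:~R < pairing m (toNR R u)).
suff H : forall sigma, sigma \in s ->
    exists N, forall n, (N <= n)%N -> good sigma n.
  have [N HN] := large_all H; exists N => n Nn sigma ms _; apply: HN => //.
  by apply/sS; exact: ms.1.
move=> sigma _; have [ms|nms] := pselect (maximal_cone Sigma sigma);
  last by exists 0%N => n _ /nms.
have [s0 ss0 sub0] := ref _ ms.1; have [tau mtau sub1] := maximal_cone_above ss0.
have sub : (sigma `<=` tau)%classic by apply: subset_trans sub1.
have [m0 [m0e m0l]] := ampa tau mtau (fun _ _ => I).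
have [m1 [m1e m1l]] := ampb tau mtau.1 sigma ms sub.
have m0t u : G Sigma u -> tau (toNR R u) -> pairing m0 (toNR R u) = - (a u)%:~R.
  by move=> Gu tu; apply/m0e/(ray_gensP _ mtau.1); rewrite -eG.
pose strict u n := G Sigma u -> ~ sigma (toNR R u) ->
  - (ab n u)%:~R < n%:R * pairing m0 (toNR R u) + pairing m1 (toNR R u).
have [u _|N HN] := @large_all _ verts strict.
  have [tu|ntu] := pselect (tau (toNR R u)).
    exists 0%N => n _ Gu nsu; rewrite m0t // rmorphD rmorphM /= opprD mulrN.
    by rewrite ltrD2l; exact: m1l.
  have [Gu|nGu] := pselect (G Sigma u); last by exists 0%N => n _ /nGu.
  have pos : 0 < pairing m0 (toNR R u) + (a u)%:~R.
    by rewrite -[(a u)%:~R]opprK subr_gt0 m0l // -eG.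
  have [N HN] := large_multiple_gt (- (b u)%:~R - pairing m1 (toNR R u)) pos.
  exists N => n /HN + _ _; rewrite rmorphD rmorphM /= mulrDr.
  rewrite -[n%:~R]/(n%:R); lra.
exists N => n Nn _; exists (n%:R *: m0 + m1); split=> u.
  move=> su; have [Gu s1u] := (ray_gensP _ ms.1).1 su.
  rewrite pairingDl pairingZl m1e // m0t //; last exact: sub.
  by rewrite rmorphD rmorphM /= opprD mulrN.
move=> Gu _ nsu; rewrite pairingDl pairingZl; apply: HN => //; exact: vertsP.
Qed.

End Projectivity.

Lemma eq_minimal_nonface (K : choiceType) (vertex : K -> Prop)
    (f f' : {fset K} -> Prop) P :
  (forall A, (forall u, u \in A -> vertex u) -> f A <-> f' A) ->
  minimal_nonface vertex f P <-> minimal_nonface vertex f' P.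
Proof.
move=> ff'; suff imp g g' : (forall A, (forall u, u \in A -> vertex u) ->
    g A <-> g' A) -> minimal_nonface vertex g P -> minimal_nonface vertex g' P.
  by split; apply: imp => // A /ff' H; split=> /H.
move=> gg' [P0 vP nP Pu]; split=> // [/(gg' _ vP) //|u uP].
apply/gg'; last exact: Pu.
by move=> w; rewrite !inE => /andP[_ /vP].
Qed.

Theorem theorem2p4 (R : realType) (d : nat) (Sigma Sigmaplus : fan R d)
    (U V : {fset lattice d})
    (Ssmooth : smooth Sigma) (Sproj : projective Sigma)
    (UVrel : primitive_relation Sigma U V (fun=> 1%N))
    (UVext : extremal Sigma (relation_class R U V (fun=> 1%N)))
    (ltlm : (#|` U| < #|` V|)%N)
    (Saf : antiflip Sigma (relation_class R U V (fun=> 1%N)) Sigmaplus) :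
  [/\ smooth Sigmaplus,
      projective Sigmaplus,
      primitive_relation Sigmaplus V U (fun=> 1%N)
    & forall P : {fset lattice d},
      primitive_collection Sigmaplus P <->
      [\/ P = V,
          [/\ primitive_collection Sigma P, ~ (V `<=` P) & P <> U]
        | exists Q : {fset lattice d},
          [/\ primitive_collection Sigma Q,
              minimal_in
                [set A | exists Q' : {fset lattice d},
                   [/\ primitive_collection Sigma Q', Q' `&` V <> fset0
                     & A = Q' `\` V]]
                (Q `\` V),
              forall S : {fset lattice d}, S `<` U ->
                ~ exists T : {fset lattice d},
                    primitive_collection Sigma T /\ T `<=` (Q `\` V) `|` S
            & P = (Q `\` V) `|` U]]].


Proof.
have [Sbar [contr smallS smallSp amp]] := Saf.
have [_ GS] := smallS; have [ref GSp] := smallSp.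
have Scomp : complete Sigma by case: Sproj.
have flips := flipped_in_Splus Ssmooth Scomp UVrel ltlm contr GS UVext ref GSp amp.
have flipc := flipped_cover Ssmooth Scomp UVrel ltlm contr GS UVext.
have GG : G Sigmaplus = G Sigma by rewrite GSp -GS.
have coverS := basic_cone_cover Ssmooth Scomp.
have genS := generates_spannedP Ssmooth Scomp.
have genSp := generates_SplusP Ssmooth Scomp UVrel ltlm contr GS UVext ref GSp amp.
have ePC : primitive_collection Sigma = minimal_nonface (G Sigma) (spanned Sigma).
  apply/funext => P; apply/propext.
  by apply: (@eq_minimal_nonface _ (G Sigma) (generates Sigma)) => A /genS.
have [primU _] := UVrel; rewrite ePC in primU.
have dUV := relation_disjoint Ssmooth Scomp UVrel ltlm.
have vV := relation_vertex Ssmooth Scomp UVrel.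
have V0 : V != fset0 by rewrite -cardfs_gt0 (leq_ltn_trans _ ltlm).
have fV : spanned Sigma V.
  by have [F bF VF] := relation_cone Ssmooth Scomp UVrel; exists F.
have ePC' : primitive_collection Sigmaplus =
    minimal_nonface (G Sigma) (generates Sigmaplus).
  by apply/funext => P; rewrite /primitive_collection GG.
have char := flipped_minimal_nonfaces (@spanned_sub R d Sigma) dUV V0 vV fV primU
    (spanned_star Ssmooth Scomp UVrel ltlm contr GS UVext) genSp.
have pV : primitive_collection Sigmaplus V.
  by rewrite ePC'; apply/char; constructor 1.
split.
- exact: cover_smooth flips flipc.
- apply: relatively_ample_projective amp => //; last by case: contr.
  by rewrite GG; exact: finite_vertices coverS.
- split=> //; have [F bF VF] := relation_cone Ssmooth Scomp UVrel.
  have [u [uU uF UF _]] := star_structure Ssmooth Scomp UVrel ltlm contr GS UVext bF VF.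
  have [v vin] : exists v, v \in V by apply/fset0Pn.
  have bE : basic_cone Sigmaplus (u |` (F `\ v)).
    by apply: flips; right; exists F, u, v.
  have UE : U `<=` u |` (F `\ v).
    apply/fsubsetP => w wU; have := fsubsetP UF _ wU; rewrite !inE.
    by case: (eqVneq w v) => // wv; case: (dUV w) => //; rewrite wv.
  exists (cone R U); split=> //.
  + exact: basic_cone_face bE UE.
  + by rewrite -(relation_sum UVrel); exact: relint_sum_gens.
  + exact: ray_gens_basic bE UE.
  + by rewrite -(relation_sum UVrel); apply: eq_bigr => w _; rewrite mulr1n.
- by move=> P; rewrite ePC ePC'; exact: char.
Qed.
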